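(* Let $r>0$ be an integer and let $(L,b,\beta)$ be a gap-free SDP problem, with $L$ and $\beta$ rational. Suppose that the primal problem has a unique optimal solution $x$, and that $x$ is generic in $S^n_{+r}$. Then there exists $\Omega$ such that $(x,\Omega)$ is a strictly complementary pair for $(L,b,\beta)$.
   Context: $S^n$ is the space of real symmetric $n\times n$ matrices with inner product $\langle A,B\rangle=\operatorname{tr}(A^tB)$ (used to identify $S^n$ with its dual), and $S^n_+$ is the cone of positive semidefinite (PSD) matrices. A semidefinite program (SDP) is a triple $(L,b,\beta)$ with $L\subset S^n$ a linear subspace and $b,\beta\in S^n$. The primal problem is $\inf_x\{\langle\beta,x\rangle : x\in(L+b)\cap S^n_+\}$, and the dual problem is $\inf_\Omega\{\langle\Omega,b\rangle:\Omega\in(L^\perp+\beta)\cap S^n_+\}$. A pair $(x,\Omega)$ is a complementary pair for $(L,b,\beta)$ if $x$ is primal feasible, $\Omega$ is dual feasible, and $\langle\Omega,x\rangle=0$ (such $x$, $\Omega$ are then optimal). The SDP is gap free if it has a complementary pair. A complementary pair is strictly complementary if $\operatorname{rank}(x)+\operatorname{rank}(\Omega)=n$. $L$ is rational if it is defined by linear equations with rational coefficients; $\beta$ is rational if its entries are rational. $S^n_{+r}$ is the set of PSD $n\times n$ matrices of rank at most $r$. A point of $S^n_{+r}$ is generic if its coordinates satisfy no polynomial equation with rational coefficients other than those satisfied by every point of $S^n_{+r}$. *)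

(* Defs.v *)
From HB Require Import structures.
From mathcomp Require Import all_boot all_order all_algebra.
From mathcomp Require Import sesquilinear.
From mathcomp Require Import reals mpoly.
Set Implicit Arguments.
Unset Strict Implicit.
Unset Printing Implicit Defensive.
Import Order.TTheory GRing.Theory Num.Theory.
Local Open Scope ring_scope.

Section Matrices.
Variables (R : realType) (n : nat).
Implicit Types (A B x : 'M[R]_n) (L : {vspace 'M[R]_n}).

Definition mxinner A B : R := \tr (A^T *m B).

Definition psdmx A : Prop :=
  A \is symmetricmx /\ forall v : 'rV[R]_n, 0 <= (v *m A *m v^T) 0 0.

Definition psdmx_rank_le (r : nat) A : Prop := psdmx A /\ (\rank A <= r)%N.

(* L is cut out of the space of symmetric matrices by finitely many linear
   equations with rational coefficients. *)
Definition rational_subspace L : Prop :=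
  exists eqs : seq 'M[rat]_n, forall A,
    A \in L <-> A \is symmetricmx /\
      (forall C, C \in eqs -> \sum_i \sum_j ratr (C i j) * A i j = 0).

Definition rational_mx A : Prop := forall i j, rational (A i j).

(* The value at A of a polynomial with rational coefficients in the n * n
   matrix entries. *)
Definition mxeval (p : {mpoly rat[n * n]}) A : R :=
  (map_mpoly ratr p).@[fun k => mxvec A 0 k].

Definition generic_in (S : 'M[R]_n -> Prop) x : Prop :=
  S x /\ forall p : {mpoly rat[n * n]},
    mxeval p x = 0 -> forall y, S y -> mxeval p y = 0.

End Matrices.

Section SDP.
Variables (R : realType) (n : nat).
Variables (L : {vspace 'M[R]_n}) (b beta : 'M[R]_n).
Implicit Types x Omega : 'M[R]_n.

Definition is_sdp : Prop :=
  [/\ {subset L <= symmetricmx}, b \is symmetricmx & beta \is symmetricmx].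

Definition primal_feasible x : Prop := x - b \in L /\ psdmx x.

(* Omega lies in L^perp + beta, where L^perp is taken inside the space of
   symmetric matrices; Omega - beta is symmetric as psdmx Omega includes
   symmetry and beta is symmetric in an SDP. *)
Definition dual_feasible Omega : Prop :=
  (forall A, A \in L -> mxinner (Omega - beta) A = 0) /\ psdmx Omega.

Definition primal_optimal x : Prop :=
  primal_feasible x /\
  forall y, primal_feasible y -> mxinner beta x <= mxinner beta y.

Definition complementary_pair x Omega : Prop :=
  [/\ primal_feasible x, dual_feasible Omega & mxinner Omega x = 0].

Definition gap_free : Prop := exists x Omega, complementary_pair x Omega.

Definition strictly_complementary_pair x Omega : Prop :=
  complementary_pair x Omega /\ (\rank x + \rank Omega = n)%N.

End SDP.

(* Main.v *)
From HB Require Import structures.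
Require Import Defs.
From mathcomp Require Import all_boot all_order all_algebra.
From mathcomp Require Import sesquilinear.
From mathcomp Require Import all_classical all_reals.
From mathcomp Require Import topology normedtype derive.
From mathcomp Require Import ring lra.
(* The notations of mpoly clash with those of MathComp-Analysis; its canonical
   instances are still needed. *)
From mathcomp Require Import -(notations) mpoly.
Set Implicit Arguments.
Unset Strict Implicit.
Unset Printing Implicit Defensive.
Import Order.TTheory GRing.Theory Num.Theory numFieldNormedType.Exports.
Local Open Scope classical_set_scope.
Local Open Scope ring_scope.

(* Let E be the set of A in L with <beta, A> = 0; uniqueness of the optimum says
   that x + Z is PSD for no nonzero Z in E.  If no strictly complementary dual
   solution existed, separation (Gordan's alternative) would give a nonzero
   A = B B^T + x C + C^T x in E.  Since x is generic and E is rational, this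
   polynomial system in (B, C) stays solvable when x is moved to a nearby y in
   S_+r, with a solution near (B, C): adjoin the entries of B and C to Q[x] one
   at a time; a transcendental entry is kept, and an algebraic one is a simple
   root, which persists under small changes.  Following the resulting directions
   by Euler steps y -> (1 + h C_y)^T y (1 + h C_y), which stay in S_+r, and
   collecting the discarded PSD terms h B_y B_y^T, shows in the limit h -> 0 that
   x + Z is PSD for some Z in E close to a positive multiple of A: a
   contradiction. *)

(** * Persistence of real solutions at a generic point *)

Lemma horner_cont (R : realType) (p : {poly R}) (c e : R) : 0 < e ->
  exists2 d : R, 0 < d & forall z, `|z - c| < d -> `|p.[z] - p.[c]| < e.
Proof.
move=> e_gt0; have /cvgrPdist_lt/(_ e e_gt0) := @continuous_horner R p c.
rewrite -nbhs_ballE => -[d /= d_gt0 cd]; exists d => // z zc.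
by rewrite distrC; apply: cd; rewrite /ball /= distrC.
Qed.

(** Continuity jointly in the argument and in the coefficients, for sizes bounded by [k]: in [q.[z]
    - p.[c] = (q - p).[z] + (p.[z] - p.[c])] the first term is at most the largest coefficient
    difference times [S], which bounds the powers of [z] near [c]. *)
Lemma horner_cont2 (R : realType) (k : nat) (p : {poly R}) (c e : R) :
  0 < e -> (size p <= k)%N ->
  exists2 d : R, 0 < d & forall q : {poly R}, (size q <= k)%N ->
    (forall i, `|q`_i - p`_i| < d) ->
    forall z, `|z - c| < d -> `|q.[z] - p.[c]| < e.
Proof.
move=> e_gt0 szp; have e2 : 0 < e / 2 by lra.
have [d d_gt0 cd] := horner_cont p c e2.
have c_ge0 := normr_ge0 c.
have [S ES S_ge0] : exists2 S, S = \sum_(i < k) (`|c| + 1) ^+ i & 0 <= S.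
  by eexists; first reflexivity; apply: sumr_ge0 => i _; apply: exprn_ge0; lra.
pose h := e / (2 * (S + 1)).
have h_gt0 : 0 < h by rewrite divr_gt0 //; lra.
exists (Num.min d (Num.min 1 h)); first by rewrite !lt_min d_gt0 h_gt0 ltr01.
move=> q szq qp z; rewrite !lt_min => /and3P[zd z1 zh].
have zc : `|z| <= `|c| + 1.
  by rewrite -[z](subrK c) (le_trans (ler_normD _ _)) // addrC lerD2l ltW.
have -> : q.[z] - p.[c] = (q - p).[z] + (p.[z] - p.[c]).
  by rewrite hornerD hornerN; ring.
apply: le_lt_trans (ler_normD _ _) _.
suff qpz : `|(q - p).[z]| <= e / 2 by have := cd z zd; lra.
have szqp : (size (q - p)%R <= k)%N.
  by rewrite (leq_trans (size_polyD _ _)) // size_polyN geq_max szq.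
rewrite (horner_coef_wide _ szqp) (le_trans (ler_norm_sum _ _ _)) //.
have : \sum_(i < k) `|(q - p)`_i * z ^+ i| <= h * S.
  rewrite ES mulr_sumr; apply: ler_sum => i _; rewrite normrM normrX coefB.
  apply: ler_pM => //; first by rewrite exprn_ge0.
    by have := qp i; rewrite !lt_min => /and3P[_ _ /ltW].
  by apply: lerXn2r; rewrite ?nnegrE ?addr_ge0.
move/le_trans; apply.
have -> : h * S = e / 2 * (S / (S + 1)) by rewrite /h; field; apply: lt0r_neq0; lra.
rewrite -[leRHS]mulr1 ler_wpM2l; [by []|lra|].
by rewrite ler_pdivrMr; lra.
Qed.

(** Write [p = q * ('X - b)]. Then [q.[b]] is the derivative of [p] at [b], so [q] keeps its sign
    near [b], and the product of the two values of [p] is [- h ^+ 2] times the product of those of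
    [q]. *)
Lemma simple_root_sign_change (R : realType) (p : {poly R}) (b e : R) :
  0 < e -> root p b -> p^`().[b] != 0 ->
  exists2 h : R, 0 < h < e & p.[b - h] * p.[b + h] < 0.
Proof.
move=> e_gt0 /factor_theorem[q ->].
rewrite derivM derivXsubC hornerD !hornerM hornerXsubC subrr mulr0 add0r.
rewrite hornerC mulr1 => qb.
have [d d_gt0 qd] : exists2 d : R, 0 < d &
    forall z, `|z - b| < d -> 0 < q.[z] * q.[b].
  have qb0 : 0 < `|q.[b]| by rewrite normr_gt0.
  have [d d_gt0 cd] := horner_cont q b qb0; exists d => // z /cd.
  rewrite ltr_norml => /andP[]; move: qb; rewrite neq_lt => /orP[qb|qb].
    by rewrite (ltr0_norm qb) => h1 h2; rewrite nmulr_lgt0 //; lra.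
  by rewrite (gtr0_norm qb) => h1 h2; rewrite pmulr_lgt0 //; lra.
have md : 0 < Num.min d e by rewrite lt_min d_gt0.
have : Num.min d e <= d /\ Num.min d e <= e by rewrite !ge_min !lexx orbT.
set m := Num.min d e in md * => -[m_d m_e].
exists (m / 2); first by apply/andP; split; lra.
rewrite !hornerM !hornerXsubC.
have := qd (b - m / 2); have := qd (b + m / 2).
rewrite addrAC subrr add0r [b - _ - b]addrAC subrr add0r normrN gtr0_norm; last lra.
move=> /(_ ltac:(lra)) h1 /(_ ltac:(lra)) h2.
have h3 : 0 < q.[b - m / 2] * q.[b + m / 2].
  have : 0 < (q.[b - m / 2] * q.[b + m / 2]) * (q.[b] ^+ 2).
    rewrite (_ : _ * _ =
      (q.[b - m / 2] * q.[b]) * (q.[b + m / 2] * q.[b])) //; last by ring.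
    exact: mulr_gt0.
  by rewrite pmulr_lgt0 // exprn_even_gt0.
have : 0 < (m / 2) ^+ 2 by rewrite exprn_gt0 //; lra.
move=> /(mulr_gt0 h3); lra.
Qed.

Lemma mulr_gt0_near (R : realFieldType) (u v : R) : `|u - v| < `|v| -> 0 < u * v.
Proof.
rewrite ltr_norml => /andP[].
have [v0|v0|->] := ltrgtP v 0; rewrite ?normr0; last lra.
  by rewrite ltr0_norm // => h1 h2; rewrite nmulr_lgt0 //; lra.
by rewrite gtr0_norm // => h1 h2; rewrite pmulr_lgt0 //; lra.
Qed.

(** * Transfer of solutions when real numbers are adjoined one at a time *)

Section Transfer.
Variables (R : realType) (Y : Type) (F : set_system Y).
Context {FF : Filter F}.
Variables (A0 : comNzRingType) (ev : Y -> {rmorphism A0 -> R}).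

(* [A] is a ring of polynomials over [A0] in auxiliary unknowns, and a real point
   is a ring morphism to [R].  The system [Z], solved by [phi0], is also solved
   over every nearby [y], with the values of [G] moving little. *)
Definition transferable (A : comNzRingType) (iota : {rmorphism A0 -> A})
    (phi0 : {rmorphism A -> R}) : Prop :=
  forall (Z G : seq A) (e : R), 0 < e -> (forall a, a \in Z -> phi0 a = 0) ->
  \forall y \near F, exists phi : {rmorphism A -> R},
    [/\ forall a, phi (iota a) = ev y a,
        forall a, a \in Z -> phi a = 0
      & forall g, g \in G -> `|phi g - phi0 g| < e].

Definition hornerm (A : comNzRingType) (phi : {rmorphism A -> R}) (b : R) :
  {rmorphism {poly A} -> R} := horner_eval b \o map_poly phi.

Lemma hornermE (A : comNzRingType) (phi : {rmorphism A -> R}) b p :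
  hornerm phi b p = (map_poly phi p).[b].
Proof. by []. Qed.

Lemma hornermC (A : comNzRingType) (phi : {rmorphism A -> R}) b a :
  hornerm phi b a%:P = phi a.
Proof. by rewrite hornermE map_polyC hornerC. Qed.

Lemma hornermX (A : comNzRingType) (phi : {rmorphism A -> R}) b :
  hornerm phi b 'X = b.
Proof. by rewrite hornermE map_polyX hornerX. Qed.

(** Reduces closeness on finitely many polynomials over [A] to closeness on their coefficients,
    which is what transferability over [A] can provide. *)
Lemma hornerm_near (A : comNzRingType) (phi0 : {rmorphism A -> R}) (b e : R)
    (G : seq {poly A}) : 0 < e ->
  exists2 d : R, 0 < d & forall (phi : {rmorphism A -> R}) c, `|c - b| < d ->
    (forall (g : {poly A}) a, g \in G -> a \in (g : seq A) ->
      `|phi a - phi0 a| < d) ->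
    forall g, g \in G -> `|hornerm phi c g - hornerm phi0 b g| < e.
Proof.
move=> e_gt0; elim: G => [|g G [d d_gt0 IH]]; first by exists 1.
have [d' d'_gt0 IHg] :=
  horner_cont2 b e_gt0 (size_poly _ _ : (size (map_poly phi0 g) <= size g)%N).
exists (Num.min d d') => [|phi c]; first by rewrite lt_min d_gt0.
rewrite lt_min => /andP[cd cd'] gG h; rewrite inE => /predU1P[->|hG].
  rewrite !hornermE; apply: IHg => //; first exact: size_poly.
  move=> i; rewrite !coef_map /=.
  have [ig|ig] := ltnP i (size g); last first.
    by rewrite (nth_default 0 ig) !rmorph0 subrr normr0.
  have := gG g g`_i; rewrite mem_head mem_nth // lt_min.
  by move=> /(_ isT isT) /andP[].
apply: IH => // f a fG af; have := gG f a; rewrite inE fG orbT lt_min.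
by move=> /(_ isT af) /andP[].
Qed.

Section Step.
Variables (A : comNzRingType) (iota : {rmorphism A0 -> A}).
Variables (phi0 : {rmorphism A -> R}) (b : R).
Hypothesis tr : transferable iota phi0.

(* [b] is algebraic over [phi0 A] if and only if there is such an [m]. *)
Let good (m : {poly A}) :=
  hornerm phi0 b m = 0 /\ phi0 (lead_coef m) != 0.

(** If [phi0] did not kill all coefficients of [f], cutting [f] off at the size of its image would
    leave the image unchanged and give a leading coefficient not killed by [phi0]: a good polynomial
    of size at most [d]. *)
Lemma good_coef d : (forall m, good m -> (d < size m)%N) ->
  forall f : {poly A}, (size f <= d)%N -> hornerm phi0 b f = 0 ->
  forall a, a \in (f : seq A) -> phi0 a = 0.
Proof.
move=> dmin f szf f0 a /(nthP 0)[i _ <-]; rewrite -coef_map.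
suff -> : map_poly phi0 f = 0 by rewrite coef0.
apply/eqP/negP => /negP nz.
pose k := size (map_poly phi0 f).
have ef : map_poly phi0 (take_poly k f) = map_poly phi0 f.
  apply/polyP => j; rewrite !coef_map /= coef_take_poly; case: ltnP => // kj.
  by rewrite rmorph0 -coef_map /= nth_default.
have kf : (k <= size f)%N by exact: size_poly.
have lcf : (take_poly k f)`_k.-1 = f`_k.-1.
  by rewrite coef_take_poly prednK ?leqnn // lt0n size_poly_eq0.
have lc0 : phi0 f`_k.-1 != 0 by rewrite -coef_map -lead_coefE lead_coef_eq0.
have sz : size (take_poly k f) = k.
  apply/eqP; rewrite eqn_leq size_poly /=.
  rewrite leqNgt; apply/negP => lt; move: lc0.
  rewrite -lcf nth_default ?rmorph0 ?eqxx // -ltnS prednK //.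
  by rewrite lt0n size_poly_eq0.
have : good (take_poly k f).
  split; first by rewrite hornermE ef.
  by rewrite lead_coefE sz lcf.
by move/dmin; rewrite sz ltnNge (leq_trans kf).
Qed.

Lemma hornerm_polyC phi c a : hornerm phi c ((polyC \o iota) a) = phi (iota a).
Proof. exact: hornermC. Qed.

(** For [b] transcendental over the image of [phi0], an equation holds at [b] only if all its
    coefficients vanish under [phi0]. So the coefficients are transferred as equations over [A], and
    [b] itself is kept. *)
Lemma transferable_trans : (forall m, ~ good m) ->
  transferable (polyC \o iota : {rmorphism A0 -> {poly A}}) (hornerm phi0 b).
Proof.
move=> nogood Z G e e_gt0 Z0.
have [d d_gt0 cd] := hornerm_near phi0 b G e_gt0.
have cZ : forall a, a \in flatten (map polyseq Z) -> phi0 a = 0.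
  move=> a /flatten_mapP[z zZ az].
  by apply: (@good_coef (size z) _ z (leqnn _) (Z0 _ zZ)) => // m /nogood.
have := tr (flatten (map polyseq G)) d_gt0 cZ.
apply: filterS => y [phi [phiev phiZ phiG]]; exists (hornerm phi b); split.
- by move=> a; rewrite hornerm_polyC.
- move=> z zZ; rewrite hornermE (_ : map_poly phi z = 0) ?horner0 //.
  apply/polyP => i; rewrite coef_map coef0 /=.
  have [iz|iz] := ltnP i (size z); last by rewrite nth_default ?rmorph0.
  by apply: phiZ; apply/flatten_mapP; exists z => //; exact: mem_nth.
- apply: cd; first by rewrite subrr normr0.
  by move=> g a gG ag; apply: phiG; apply/flatten_mapP; exists g.
Qed.

(** By minimality [b] is a simple root of the image of [m], so the perturbed image has a root [c]
    near [b]. Pseudo-division by [m] turns each equation into the vanishing of the coefficients of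
    its remainder, which is a system over [A]. *)
Lemma transferable_alg m : good m -> (forall p, good p -> (size m <= size p)%N) ->
  transferable (polyC \o iota : {rmorphism A0 -> {poly A}}) (hornerm phi0 b).
Proof.
move=> [m0 lm0] mmin Z G e e_gt0 Z0.
have m_neq0 : m != 0.
  by apply: contraNneq lm0 => ->; rewrite lead_coef0 rmorph0.
have sm : (0 < size m)%N by rewrite lt0n size_poly_eq0.
have small (f : {poly A}) : (size f < size m)%N -> hornerm phi0 b f = 0 ->
    forall a, a \in (f : seq A) -> phi0 a = 0.
  move=> fm; apply: (@good_coef (size m).-1); last by rewrite -ltnS prednK.
  by move=> p /mmin; rewrite -ltnS prednK.
(* A derivative vanishing at [b] would be a shorter relation, so [phi0] would kill its coefficients.
   The one of index [(size m).-2] is a positive multiple of [lead_coef m]. *)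
have simple : (map_poly phi0 m)^`().[b] != 0.
  rewrite deriv_map; apply/negP => /eqP d0.
  have sm1 : (1 < size m)%N.
    rewrite ltn_neqAle sm andbT eq_sym; apply/negP => /size_poly1P[c c0 mc].
    by move: m0 lm0; rewrite mc hornermC lead_coefC => ->; rewrite eqxx.
  have := small _ (lt_size_deriv m_neq0) d0 (m^`())`_(size m).-2.
  (* That multiple may already be zero in [A], making the derivative shorter still; its image under
     [phi0] is zero in both cases. *)
  have [lt|ge] := ltnP (size m).-2 (size m^`()).
    move=> /(_ (mem_nth _ lt)); rewrite coef_deriv prednK;
      last by rewrite -subn1 subn_gt0.
    rewrite rmorphMn /= -lead_coefE => /eqP; rewrite mulrn_eq0 (negbTE lm0) orbF.
    by rewrite -subn1 subn_eq0 leqNgt sm1.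
  have := nth_default 0 ge; rewrite coef_deriv prednK; last by rewrite -subn1 subn_gt0.
  move=> /(congr1 phi0); rewrite rmorphMn rmorph0 /= -lead_coefE => /eqP.
  by rewrite mulrn_eq0 (negbTE lm0) orbF -subn1 subn_eq0 leqNgt sm1.
have [d d_gt0 cd] := hornerm_near phi0 b G e_gt0.
have rb : root (map_poly phi0 m) b by rewrite rootE -hornermE m0.
have [h /andP[h_gt0 hd] hneg] := simple_root_sign_change d_gt0 rb simple.
set p0 := map_poly phi0 m in hneg rb simple.
have : p0.[b - h] != 0 /\ p0.[b + h] != 0.
  by split; apply: contraTneq hneg => ->; rewrite ?mul0r ?mulr0 ltxx.
rewrite -!normr_gt0 => -[nl nr].
have [dl dl_gt0 cl] := hornerm_near phi0 (b - h) [:: m] nl.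
have [dr dr_gt0 cr] := hornerm_near phi0 (b + h) [:: m] nr.
have lc_gt0 : 0 < `|phi0 (lead_coef m)| by rewrite normr_gt0.
(* Within [dd], the values of [G] stay close, those of [m] at [b - h] and [b + h] keep their signs,
   and the leading coefficient of [m] stays nonzero. *)
pose dd := Num.min (Num.min d dl) (Num.min dr `|phi0 (lead_coef m)|).
have dd_gt0 : 0 < dd by rewrite !lt_min d_gt0 dl_gt0 dr_gt0.
pose rem z := Pdiv.Ring.rmodp z m.
have remE z := Pdiv.ComRing.rdivp_eq m z.
have rem0 z : z \in Z -> forall a, a \in (rem z : seq A) -> phi0 a = 0.
  move=> zZ; apply: small; first by rewrite Pdiv.Ring.ltn_rmodp.
  have := congr1 (hornerm phi0 b) (remE z).
  by rewrite -mul_polyC rmorphD !rmorphM m0 (Z0 z zZ) !mulr0 add0r.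
have cZ : forall a, a \in flatten [seq polyseq (rem z) | z <- Z] -> phi0 a = 0.
  by move=> a /flatten_mapP[z zZ]; exact: rem0.
have := tr (m ++ flatten (map polyseq G)) dd_gt0 cZ.
apply: filterS => y [phi [phiev phiZ phiG]].
have phim (a : A) : a \in (m : seq A) -> `|phi a - phi0 a| < dd.
  by move=> am; apply: phiG; rewrite mem_cat am.
have dist0 (c : R) : 0 < c -> forall t : R, `|t - t| < c.
  by move=> c0 t; rewrite subrr normr0.
pose p := map_poly phi m.
have hl : `|p.[b - h] - p0.[b - h]| < `|p0.[b - h]|.
  apply: (cl phi (b - h)); rewrite ?mem_seq1 ?dist0 // => g a.
  rewrite inE => /eqP -> /phim; rewrite !lt_min.
  by move=> /andP[/andP[_ ->]].
have hr : `|p.[b + h] - p0.[b + h]| < `|p0.[b + h]|.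
  apply: (cr phi (b + h)); rewrite ?mem_seq1 ?dist0 // => g a.
  rewrite inE => /eqP -> /phim; rewrite !lt_min.
  by move=> /andP[_ /andP[->]].
have plc : phi (lead_coef m) != 0.
  have /phim : lead_coef m \in (m : seq A).
    by rewrite lead_coefE mem_nth // prednK.
  rewrite !lt_min => /andP[_ /andP[_]]; apply: contraTneq => ->.
  by rewrite sub0r normrN ltxx.
(* The signs at the two ends are still opposite. [poly_ivt] wants them increasing, so the other case
   is applied to [- p]. *)
have [c /andP[c1 c2] pc] : exists2 c, b - h <= c <= b + h & root p c.
  have lh : b - h <= b + h by lra.
  have := mulr_gt0_near hl; have := mulr_gt0_near hr => s1 s2.
  have [l0|l0] := ltP p.[b - h] 0.
    apply: poly_ivt => //; apply/andP; split; first lra.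
    move: s2 hneg s1; rewrite nmulr_rgt0 // => q0; rewrite nmulr_rlt0 // => q1.
    by rewrite pmulr_lgt0 // => /ltW.
  have {}l0 : 0 < p.[b - h].
    by rewrite lt_neqAle l0 andbT; apply: contraTneq s2 => <-; rewrite mul0r ltxx.
  have [|c c12 rc] := @poly_ivt R (- p) _ _ lh.
    rewrite !hornerN; apply/andP; split; first lra.
    move: s2 hneg s1; rewrite pmulr_rgt0 // => q0; rewrite pmulr_rlt0 // => q1.
    by rewrite nmulr_lgt0 // oppr_ge0 => /ltW.
  by exists c => //; move: rc; rewrite /root hornerN oppr_eq0.
exists (hornerm phi c); split.
- by move=> a; rewrite hornerm_polyC.
- move=> z zZ; have := congr1 (hornerm phi c) (remE z).
  rewrite -mul_polyC rmorphD !rmorphM hornermC.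
  have -> : hornerm phi c m = 0 by apply/eqP; exact: pc.
  have -> : hornerm phi c (Pdiv.Ring.rmodp z m) = 0.
    rewrite hornermE (_ : map_poly phi _ = 0) ?horner0 //.
    apply/polyP => i; rewrite coef_map coef0 /=.
    have [iz|iz] := ltnP i (size (rem z)); last by rewrite nth_default ?rmorph0.
    by apply: phiZ; apply/flatten_mapP; exists z => //; exact: mem_nth.
  (* What vanishes is [z] times a power of the leading coefficient of [m]; that power is nonzero at
     the new point. *)
  rewrite mulr0 addr0 => /eqP; rewrite mulf_eq0 rmorphXn expf_eq0 (negbTE plc).
  by rewrite andbF /= => /eqP.
- apply: cd; first by rewrite ltr_norml; apply/andP; split; lra.
  move=> g a gG ag.
  have : a \in m ++ flatten (map polyseq G).
    by rewrite mem_cat; apply/orP; right; apply/flatten_mapP; exists g.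
  by move=> /phiG; rewrite !lt_min => /andP[/andP[->]].
Qed.

Lemma transferable_poly :
  transferable (polyC \o iota : {rmorphism A0 -> {poly A}}) (hornerm phi0 b).
Proof.
have [[m gm]|nogood] := pselect (exists m, good m); last first.
  by apply: transferable_trans => m gm; apply: nogood; exists m.
pose P k := `[< exists2 m, good m & size m = k >].
have exP : exists k, P k by exists (size m); apply/asboolP; exists m.
case: (ex_minnP exP) => k /asboolP[m' gm' <-] kmin.
apply: (transferable_alg gm') => p gp; apply: kmin; apply/asboolP.
by exists p.
Qed.

End Step.

(** Induction on [bs]. Over [A0] itself [ev y] is the required morphism: the first hypothesis
    preserves equations and the second gives closeness. Each further number adds one unknown, and
    [s] collects ring elements with the values [bs]. *)
Theorem transfer (phi0 : {rmorphism A0 -> R}) (bs : seq R) :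
  (forall a, phi0 a = 0 -> \forall y \near F, ev y a = 0) ->
  (forall a (e : R), 0 < e -> \forall y \near F, `|ev y a - phi0 a| < e) ->
  exists (A : comNzRingType) (iota : {rmorphism A0 -> A})
      (psi : {rmorphism A -> R}) (s : seq A),
    [/\ transferable iota psi, forall a, psi (iota a) = phi0 a & map psi s = bs].
Proof.
move=> gen cont; elim: bs => [|b bs [A [iota [psi [s [tr ei <-]]]]]].
  exists A0, idfun, phi0, [::]; split => // Z G e e_gt0 Z0.
  have nG : \forall y \near F, forall g, g \in G -> `|ev y g - phi0 g| < e.
    elim: G => [|g G IH]; first by apply: nearW.
    have := cont g e e_gt0; apply: filterS2 IH => y hG hg f.
    by rewrite inE => /predU1P[->|/hG].
  have nZ : \forall y \near F, forall g, g \in Z -> ev y g = 0.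
    elim: Z Z0 {nG} => [|g Z IH] Z0; first by apply: nearW.
    have := gen g (Z0 g (mem_head _ _)).
    have {}IH := IH (fun a aZ => Z0 a (mem_behead (s:=g::Z) aZ)).
    apply: filterS2 IH => y hG hg f.
    by rewrite inE => /predU1P[->|/hG].
  by apply: filterS2 nZ nG => y hZ hG; exists (ev y).
exists {poly A}, (polyC \o iota), (hornerm psi b), ('X :: map polyC s).
split; first exact: transferable_poly.
- by move=> a; rewrite hornerm_polyC.
- have eC : map (hornerm psi b) (map polyC s) = map psi s.
    by rewrite -map_comp; apply: eq_map => a; exact: hornermC.
  by rewrite map_cons hornermX eC.
Qed.

End Transfer.

(** * The tangent equations near a generic matrix *)

Lemma mxeval_continuous (R : realType) n (p : mpoly.mpoly (n * n) rat)
  (x : 'M[R]_n) : mxeval p y @[y --> x] --> mxeval p x.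
Proof.
pose K (f : 'M[R]_n -> R) := f y @[y --> x] --> f x.
have KE f g : f =1 g -> K f -> K g by move=> /funext ->.
have Kcst c : K (fun=> c) by exact: (@cvg_cst _ c _ (nbhs x) (nbhs_filter x)).
have KD f g : K f -> K g -> K (fun y => f y + g y) by move=> cf cg; exact: (cvgD cf cg).
have KM f g : K f -> K g -> K (fun y => f y * g y) by move=> cf cg; exact: (cvgM cf cg).
have Kcoord (k : 'I_(n * n)) : K (fun y => mxvec y 0 k).
  case/mxvec_indexP: k => i j; apply: (KE (fun y => y i j)).
    by move=> y; rewrite mxvecE.
  exact: coord_continuous.
suff : K (mxeval p) by [].
elim/mpolyind: p => [|c m p _ _ IH].
  by apply: (KE (fun=> 0)) => // y; rewrite /mxeval !raddf0.
apply: (KE (fun y => ratr c * (\prod_(i < n * n) mxvec y 0 i ^+ m i)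
    + mxeval p y)) => [y|].
  rewrite /mxeval !raddfD /= map_mpolyZ mevalZ.
  by rewrite map_mpolyX mevalX.
apply: (KD _ _) => //; apply: (KM _ _) => //.
elim: (index_enum _) => [|i s IHs].
  by apply: (KE (fun=> 1)) => // y; rewrite big_nil.
apply: (KE (fun y => mxvec y 0 i ^+ m i * \prod_(i <- s) mxvec y 0 i ^+ m i)).
  by move=> y; rewrite big_cons.
apply: (KM _ _) => //; elim: (m i) => [|k IHk].
  by apply: (KE (fun=> 1)) => // y; rewrite expr0.
apply: (KE (fun y => mxvec y 0 i * mxvec y 0 i ^+ k)) => [y|]; last exact: KM.
by rewrite exprS.
Qed.

Section MatrixTransfer.
Variables (R : realType) (n k : nat).
Implicit Types (y C : 'M[R]_n) (B : 'M[R]_(n, k)).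

(* For a symmetric [y], these are the directions that are PSD as a form on the
   kernel of [y]. *)
Definition tangent (A : comNzRingType) (y : 'M[A]_n) (B : 'M[A]_(n, k))
  (C : 'M[A]_n) : 'M[A]_n := B *m B^T + (y *m C + C^T *m y).

Lemma map_tangent (A A' : comNzRingType) (f : {rmorphism A -> A'})
    (y : 'M[A]_n) (B : 'M[A]_(n, k)) (C : 'M[A]_n) :
  map_mx f (tangent y B C) = tangent (map_mx f y) (map_mx f B) (map_mx f C).
Proof. by rewrite /tangent !map_mxD !map_mxM !map_trmx. Qed.

Definition rat_inner (q : 'M[rat]_n) y := \sum_i \sum_j ratr (q i j) * y i j.

(** [transfer] over the rational polynomials in the matrix entries, evaluated at [x], with the
    entries of [B] and [C] adjoined. Genericity is exactly its hypothesis that equations true at [x]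
    hold at nearby points of [S]. *)
Lemma generic_tangent (S : 'M[R]_n -> Prop) x B C (eqs : seq 'M[rat]_n) (e : R) :
  generic_in S x -> 0 < e ->
  (forall q, q \in eqs -> rat_inner q (tangent x B C) = 0) ->
  \forall y \near within S (nbhs x), exists B' C',
    [/\ forall q, q \in eqs -> rat_inner q (tangent y B' C') = 0,
        forall i j, `|(tangent y B' C' - tangent x B C) i j| < e
      & forall i j, `|(C' - C) i j| < e].
Proof.
move=> [Sx gen] e_gt0 eqsx.
pose ev y : {rmorphism mpoly.mpoly (n * n) rat -> R} :=
  mpoly.meval (fun i => mxvec y 0 i) \o mpoly.map_mpoly ratr.
pose bs := [seq B ij.1 ij.2 | ij : 'I_n * 'I_k] ++
  [seq C ij.1 ij.2 | ij : 'I_n * 'I_n].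
have [||A [iota [psi [s [tr ei es]]]]] :=
    @transfer R _ (within S (nbhs x)) _ _ ev (ev x) bs.
- move=> a a0; rewrite near_withinE; apply: nearW => y Sy.
  exact: gen Sy.
- move=> a e' e'_gt0; rewrite near_withinE.
  have /cvgrPdist_lt/(_ _ e'_gt0) := @mxeval_continuous R n a x.
  by apply: filterS => y h _; rewrite distrC.
have lift p q (M : 'M[R]_(p, q)) : (forall i j, M i j \in bs) ->
    exists Ms : 'M[A]_(p, q), map_mx psi Ms = M.
  move=> Mbs; have /choice[f fP] : forall ij : 'I_p * 'I_q, exists a, psi a = M ij.1 ij.2.
    move=> ij; have := Mbs ij.1 ij.2; rewrite -es => /mapP[a _ ->].
    by exists a.
  exists (\matrix_(i, j) f (i, j)); apply/matrixP => i j.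
  by rewrite !mxE fP.
have [i j|Bs eB] := lift _ _ B.
  by rewrite mem_cat; apply/orP; left; apply/fintype.imageP; exists (i, j).
have [i j|Cs eC] := lift _ _ C.
  by rewrite mem_cat; apply/orP; right; apply/fintype.imageP; exists (i, j).
(* The matrix of coordinate variables, numbered as [mxvec] does; every transferred morphism over [y]
   sends it to [y]. *)
pose Xs : 'M[A]_n :=
  \matrix_(i, j) iota (mpoly.mpolyX rat (mpoly.mnm1 (mxvec_index i j))).
have eX (phi : {rmorphism A -> R}) y : (forall a, phi (iota a) = ev y a) ->
    map_mx phi Xs = y.
  move=> phiE; apply/matrixP => i j; rewrite !mxE phiE /ev /=.
  by rewrite mpoly.map_mpolyX mpoly.mevalXU mxvecE.
pose Ts := tangent Xs Bs Cs.
pose eq (q : 'M[rat]_n) := \sum_i \sum_j iota (mpoly.mpolyC _ (q i j)) * Ts i j.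
have eqE (phi : {rmorphism A -> R}) y q : (forall a, phi (iota a) = ev y a) ->
    phi (eq q) = rat_inner q (tangent y (map_mx phi Bs) (map_mx phi Cs)).
  move=> phiE; rewrite /eq /rat_inner rmorph_sum; apply: eq_bigr => i _.
  rewrite rmorph_sum; apply: eq_bigr => j _; rewrite rmorphM phiE /ev /=.
  rewrite mpoly.map_mpolyC mpoly.mevalC; congr (_ * _).
  by rewrite -{1}(eX _ _ phiE) -map_tangent [RHS]mxE.
(* [Z] holds the equations to be preserved, [G] the entries that must move little: those of the
   tangent matrix and of [C]. *)
pose Z := map eq eqs.
pose G := [seq Ts ij.1 ij.2 | ij : 'I_n * 'I_n] ++
  [seq Cs ij.1 ij.2 | ij : 'I_n * 'I_n].
have Z0 : forall a, a \in Z -> psi a = 0.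
  by move=> a /mapP[q qe ->]; rewrite (eqE _ _ _ ei) eB eC eqsx.
have := tr Z G e e_gt0 Z0; apply: filterS => y [phi [phiE phiZ phiG]].
have subE (P Q : 'M[A]_n) i j :
    (map_mx phi P - map_mx psi Q) i j = phi (P i j) - psi (Q i j).
  by rewrite !mxE.
exists (map_mx phi Bs), (map_mx phi Cs); split.
- by move=> q qe; rewrite -(eqE _ _ _ phiE) phiZ //; exact: map_f.
- move=> i j.
  rewrite -{1}(eX _ _ phiE) -map_tangent -eB -eC -{1}(eX _ _ ei) -map_tangent.
  rewrite subE; apply: phiG; rewrite mem_cat; apply/orP; left.
  by apply/fintype.imageP; exists (i, j).
- move=> i j; rewrite -eC subE; apply: phiG; rewrite mem_cat; apply/orP; right.
  by apply/fintype.imageP; exists (i, j).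
Qed.

End MatrixTransfer.

(** * Norms and compactness for matrices, positive semidefinite matrices *)

Section MatrixNorm.
Variable R : realType.

Lemma le_mx_norm m n (M : 'M[R]_(m, n)) i j : `|M i j| <= `|M|.
Proof.
rewrite [leRHS]/Num.norm /= mx_normrE.
by apply: (@le_bigmax _ _ _ 0 (fun ij : 'I_m * 'I_n => `|M ij.1 ij.2|) (i, j)).
Qed.

Lemma mx_norm_le m n (M : 'M[R]_(m, n)) c :
  0 <= c -> (forall i j, `|M i j| <= c) -> `|M| <= c.
Proof.
move=> c0 Mc; rewrite [leLHS]/Num.norm /= mx_normrE.
by apply: bigmax_le => // -[i j] _; exact: Mc.
Qed.

Lemma mx_norm_tr m n (M : 'M[R]_(m, n)) : `|M^T| = `|M|.
Proof.
apply/eqP; rewrite eq_le; apply/andP; split; apply: mx_norm_le => // i j.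
  by rewrite mxE le_mx_norm.
by have := le_mx_norm M^T j i; rewrite mxE.
Qed.

Lemma mx_norm_vec m n (M : 'M[R]_(m, n)) : `|mxvec M| = `|M|.
Proof.
apply/eqP; rewrite eq_le; apply/andP; split; apply: mx_norm_le => //.
  by move=> i; case/mxvec_indexP => j k; rewrite ord1 mxvecE le_mx_norm.
by move=> i j; rewrite -mxvecE le_mx_norm.
Qed.

(** The norm is the largest absolute value of an entry, and an entry of the product is a sum of [n]
    terms. *)
Lemma mx_norm_mul m n p (M : 'M[R]_(m, n)) (N : 'M[R]_(n, p)) :
  `|M *m N| <= n%:R * (`|M| * `|N|).
Proof.
apply: mx_norm_le => [|i j]; first by rewrite !mulr_ge0.
rewrite mxE (le_trans (ler_norm_sum _ _ _)) //.
have -> : n%:R * (`|M| * `|N|) = \sum_(k < n) `|M| * `|N|.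
  by rewrite sumr_const card_ord mulr_natl.
by apply: ler_sum => k _; rewrite normrM ler_pM // le_mx_norm.
Qed.

Lemma linear_bounded m n p q (f : {linear 'M[R]_(m, n) -> 'M[R]_(p, q)}) :
  exists2 K : R, 0 < K & forall M, `|f M| <= K * `|M|.
Proof.
pose K := 1 + \sum_i \sum_j `|f (delta_mx i j)|.
have s0 : 0 <= \sum_i \sum_j `|f (delta_mx i j)|.
  by apply: sumr_ge0 => i _; apply: sumr_ge0.
exists K => [|M]; first by rewrite ltr_pwDl.
apply: le_trans (_ : (\sum_i \sum_j `|f (delta_mx i j)|) * `|M| <= _); last first.
  by rewrite ler_wpM2r // lerDr.
rewrite {1}[M]matrix_sum_delta linear_sum mulr_suml.
rewrite (le_trans (ler_norm_sum _ _ _)) //; apply: ler_sum => i _.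
rewrite linear_sum mulr_suml.
rewrite (le_trans (ler_norm_sum _ _ _)) //; apply: ler_sum => j _.
by rewrite linearZ normrZ mulrC ler_wpM2l // le_mx_norm.
Qed.

(** [E] is the kernel of [\1 - projv E], a bounded linear map. *)
Lemma vspace_closed m n (E : {vspace 'M[R]_(m, n)}) (M : 'M[R]_(m, n)) :
  (forall e : R, 0 < e -> exists2 Z, Z \in E & `|Z - M| < e) -> M \in E.
Proof.
move=> near; pose f := \1%VF - projv E.
have [K K_gt0 fK] := linear_bounded f.
have fE Z : Z \in E -> f Z = 0.
  by move=> ZE; rewrite !lfunE /= !lfunE /= projv_id // subrr.
suff f0 : f M = 0.
  by move: f0; rewrite !lfunE /= !lfunE /= => /subr0_eq ->; exact: memv_proj.
apply/eqP; rewrite -normr_le0; apply/ler_addgt0Pr => e e_gt0; rewrite add0r.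
have [Z ZE ZM] := near (e / K) (divr_gt0 e_gt0 K_gt0).
have -> : f M = f (M - Z) by rewrite linearB [X in _ - X]fE // subr0.
by rewrite (le_trans (fK _)) // mulrC -ler_pdivlMr // ltW // distrC.
Qed.

(** Bolzano-Weierstrass, obtained through [mxvec] from compactness of closed bounded sets of row
    vectors. *)
Lemma mx_cluster m n (u : nat -> 'M[R]_(m, n)) (c : R) :
  (forall k, `|u k| <= c) ->
  exists Z, forall (e : R) N, 0 < e -> exists2 k, (N <= k)%N & `|u k - Z| < e.
Proof.
move=> uc.
have cK : compact [set v : 'rV[R]_(m * n) | `|v| <= c].
  apply: bounded_closed_compact.
    exists c; split; first exact: num_real.
    by move=> d cd v /= /le_trans; apply; exact: ltW.
  rewrite (_ : mkset _ = Num.norm @^-1` [set r : R | r <= c]) //.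
  by apply: closed_comp; [move=> v _; exact: norm_continuous|exact: closed_le].
have [|v [_ clv]] := cK ((mxvec \o u) @ \oo) _.
  by exists 0%N => // k _ /=; rewrite mx_norm_vec.
exists (vec_mx v) => e N e_gt0.
have := clv ((mxvec \o u) @` [set k | (N <= k)%N]) (ball v e).
have uN : ((mxvec \o u) @ \oo) ((mxvec \o u) @` [set k | (N <= k)%N]).
  by exists N => // k /= Nk; exists k.
move=> /(_ uN (nbhsx_ballx _ _ e_gt0)) [_ [[k /= Nk <-]]].
rewrite -ball_normE /= => ku; exists k => //.
by rewrite -mx_norm_vec linearB /= vec_mxK distrC.
Qed.

End MatrixNorm.

Section Psd.
Variables (R : realType) (n : nat).
Implicit Types (A B D x y Z : 'M[R]_n) (v : 'rV[R]_n).

Lemma symmxP A : reflect (A^T = A) (A \is symmetricmx).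
Proof.
rewrite is_hermitianmxE expr0 scale1r map_mx_id //.
by apply: (iffP eqP) => {1}<-.
Qed.

Lemma psdmx_tr A : psdmx A -> A^T = A. Proof. by case=> /symmxP. Qed.

Lemma psdmxD A B : psdmx A -> psdmx B -> psdmx (A + B).
Proof.
move=> [/symmxP sA pA] [/symmxP sB pB]; split.
  by apply/symmxP; rewrite linearD /= sA sB.
by move=> v; rewrite mulmxDr mulmxDl mxE addr_ge0.
Qed.

Lemma psdmxZ a A : 0 <= a -> psdmx A -> psdmx (a *: A).
Proof.
move=> a0 [/symmxP sA pA]; split; first by apply/symmxP; rewrite linearZ /= sA.
by move=> v; rewrite -scalemxAr -scalemxAl mxE mulr_ge0.
Qed.

Lemma mulmx_tr_ge0 m (v : 'rV[R]_m) : 0 <= (v *m v^T) 0 0.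
Proof. by rewrite mxE sumr_ge0 // => i _; rewrite mxE -expr2 sqr_ge0. Qed.

Lemma mulmx_tr_eq0 m (v : 'rV[R]_m) : ((v *m v^T) 0 0 == 0) = (v == 0).
Proof.
apply/eqP/eqP => [|->]; last by rewrite mul0mx mxE.
rewrite mxE => /eqP; rewrite psumr_eq0; last first.
  by move=> i _; rewrite mxE -expr2 sqr_ge0.
move=> /allP v0; apply/rowP => i; rewrite mxE; apply/eqP.
by have := v0 i (mem_index_enum _); rewrite mxE -expr2 sqrf_eq0.
Qed.

Lemma psdmx_congr m (D : 'M[R]_n) (M : 'M[R]_(m, n)) :
  psdmx D -> psdmx (M *m D *m M^T).
Proof.
move=> [/symmxP sD pD]; split.
  by rewrite is_hermitianmxE expr0 scale1r map_mx_id // !trmx_mul trmxK sD mulmxA.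
by move=> v; have := pD (v *m M); rewrite trmx_mul !mulmxA.
Qed.

Lemma psdmx_mul_tr m (M : 'M[R]_(n, m)) : psdmx (M *m M^T).
Proof.
split; first by apply/symmxP; rewrite trmx_mul trmxK.
by move=> v; have := mulmx_tr_ge0 (v *m M); rewrite trmx_mul !mulmxA.
Qed.

Lemma psdmx_closed A :
  (forall e : R, 0 < e -> exists2 B, psdmx B & `|B - A| < e) -> psdmx A.
Proof.
move=> near; split.
  apply/symmxP/eqP; rewrite -subr_eq0 -normr_le0; apply/ler_addgt0Pr => e e_gt0.
  rewrite add0r; have [B /psdmx_tr sB BA] := near (e / 2) ltac:(lra).
  have -> : A^T - A = (B - A) - (B - A)^T.
    by rewrite linearB /= sB opprB [RHS]addrC addrA subrK.
  (* Symmetry passes to the limit. Nonnegativity does too: a negative value of the form at some [v]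
     would remain negative for [B] close enough to [A]. *)
  rewrite (le_trans (ler_normB _ _)) // mx_norm_tr; lra.
move=> v; rewrite leNgt; apply/negP => neg.
pose f : 'M[R]_n -> 'M[R]_1 := mulmxr v^T \o mulmx v.
have [K K_gt0 fK] := linear_bounded [the {linear _ -> _} of f].
have e_gt0 : 0 < - (v *m A *m v^T) 0 0 / K by rewrite divr_gt0 // oppr_gt0.
have [B [_ pB] BA] := near _ e_gt0.
have := le_mx_norm (f (B - A)) 0 0; have := fK (B - A).
move: BA; rewrite ltr_pdivlMr // mulrC => h1 h2 h3.
have := le_lt_trans (le_trans h3 h2) h1.
rewrite /f /= mulmxBr mulmxBl mxE [X in _ + X]mxE ltr_norml => /andP[_].
have := pB v; lra.
Qed.

End Psd.

(** * Gram factorization of PSD matrices *)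

Section Factor.
Variables (R : realType) (n : nat).
Implicit Types (A B D x y Z : 'M[R]_n) (v : 'rV[R]_n).

Definition mxform D (u v : 'rV[R]_n) : R := (u *m D *m v^T) 0 0.

Lemma mxformDl D u v w : mxform D (u + v) w = mxform D u w + mxform D v w.
Proof. by rewrite /mxform !mulmxDl mxE. Qed.

Lemma mxformZl D a u w : mxform D (a *: u) w = a * mxform D u w.
Proof. by rewrite /mxform -!scalemxAl mxE. Qed.

Lemma mxformC D u v : D^T = D -> mxform D u v = mxform D v u.
Proof.
move=> sD; rewrite /mxform -[in RHS](trmxK (v *m D *m u^T)) [RHS]mxE.
by rewrite !trmx_mul trmxK sD mulmxA.
Qed.

Lemma mxform_addZ D u v a : D^T = D ->
  mxform D (u + a *: v) (u + a *: v) =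
  mxform D u u + 2 * a * mxform D u v + a ^+ 2 * mxform D v v.
Proof.
move=> sD; rewrite mxformDl mxformZl !(mxformC _ (u + _)) //.
by rewrite !mxformDl !mxformZl (mxformC v u) //; ring.
Qed.

Lemma mxform_delta D i j : mxform D (delta_mx 0 i) (delta_mx 0 j) = D i j.
Proof. by rewrite /mxform -rowE trmx_delta -colE !mxE. Qed.

Lemma psdmx_diag_ge0 D i : psdmx D -> 0 <= D i i.
Proof. by case=> _ /(_ (delta_mx 0 i)); rewrite -/(mxform _ _ _) mxform_delta. Qed.

(** Nonnegativity of the form at the sum and the difference of two basis vectors. In particular a
    zero diagonal forces [D = 0]. *)
Lemma psdmx_norm_le D i j : psdmx D -> 2 * `|D i j| <= D i i + D j j.
Proof.
move=> psdD; have sD := psdmx_tr psdD; case: psdD => _ pD.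
have := pD (delta_mx 0 i + 1 *: delta_mx 0 j).
have := pD (delta_mx 0 i + (-1) *: delta_mx 0 j).
rewrite -!/(mxform _ _ _) !mxform_addZ // !mxform_delta => h1 h2.
by have [|] := leP 0 (D i j) => h; rewrite ?(ger0_norm h) ?(ltr0_norm h); lra.
Qed.

(** Cholesky elimination, by induction on the number of nonzero diagonal entries: subtracting
    [u *m u^T], with [u] the rescaled column [i], leaves a PSD Schur complement whose diagonal entry
    [i] is zero. *)
Lemma psdmx_factor D : psdmx D -> exists m (M : 'M[R]_(n, m)), D = M *m M^T.
Proof.
have [k] := ubnP #|[pred i | D i i != 0]|.
elim: k D => // k IH D; rewrite ltnS => cD psdD.
have [i Dii|D0] := pickP [pred i | D i i != 0]; last first.
  exists 0%N, 0; rewrite mul0mx; apply/matrixP => i j; rewrite mxE.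
  have /eqP Di := negbFE (D0 i); have /eqP Dj := negbFE (D0 j).
  have := psdmx_norm_le i j psdD; rewrite Di Dj addr0 => h.
  by apply/eqP; rewrite -normr_le0; lra.
rewrite /= in Dii; have d_gt0 : 0 < D i i by rewrite lt0r Dii psdmx_diag_ge0.
have sD := psdmx_tr psdD; case: (psdD) => _ pD.
set d := D i i in Dii d_gt0.
pose u := (Num.sqrt d)^-1 *: col i D.
have uE : u *m u^T = d^-1 *: (col i D *m (col i D)^T).
  rewrite /u linearZ /= -scalemxAr -scalemxAl scalerA -invfM -expr2.
  by rewrite sqr_sqrtr ?ltW.
have uF v : mxform (u *m u^T) v v = d^-1 * (mxform D v (delta_mx 0 i)) ^+ 2.
  rewrite uE /mxform -scalemxAr -scalemxAl mxE; congr (_ * _).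
  rewrite colE mulmxA -[v *m _ *m _ *m _ ]mulmxA -trmx_mul mulmxA.
  by rewrite mxE big_ord1 [X in _ * X]mxE -expr2 trmx_delta.
have psdD' : psdmx (D - u *m u^T).
  split; first by apply/symmxP; rewrite linearB /= trmx_mul trmxK sD.
  move=> v; rewrite mulmxBr mulmxBl mxE [X in _ + X]mxE -!/(mxform _ _ _) uF.
  (* The multiple of the basis vector minimizes the form of [D] on this line; the minimum is the
     value at [v] of the Schur complement. *)
  have := pD (v + (- (mxform D v (delta_mx 0 i) / d)) *: delta_mx 0 i).
  rewrite -/(mxform _ _ _) mxform_addZ // mxform_delta -/d.
  set a := mxform D v (delta_mx 0 i); set b := mxform D v v => h.
  have -> : b - d^-1 * a ^+ 2 = b + 2 * - (a / d) * a + (- (a / d)) ^+ 2 * d.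
    by field.
  exact: h.
have [|m [M eM]] := IH _ _ psdD'.
  apply: leq_trans cD; apply: proper_card; apply/properP; split.
    (* Zero diagonal entries stay zero, being squeezed between 0 and [D j j]. *)
    apply/fintype.subsetP => j; rewrite !inE; apply: contraNneq => Dj.
    have := psdmx_diag_ge0 j psdD'; rewrite -mxform_delta.
    rewrite /mxform mulmxBr mulmxBl mxE [X in _ + X]mxE -!/(mxform _ _ _) uF.
    rewrite !mxform_delta Dj => h; rewrite eq_le h andbT sub0r.
    by rewrite oppr_le0 mulr_ge0 ?sqr_ge0 // invr_ge0 ltW.
  exists i; rewrite inE //= negbK -mxform_delta.
  rewrite /mxform mulmxBr mulmxBl mxE [X in _ + X]mxE -!/(mxform _ _ _) uF.
  by rewrite !mxform_delta -/d subr_eq0; apply/eqP; field.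
exists (m + 1)%N, (row_mx M u).
by rewrite tr_row_mx mul_row_col -eM subrK.
Qed.

End Factor.

(** * Euler steps inside the generic family *)

Section Flow.
Variables (R : realType) (n k : nat).
Implicit Types (A C x y Z W : 'M[R]_n) (B : 'M[R]_(n, k)).
Variables (S : 'M[R]_n -> Prop) (x : 'M[R]_n) (E : {vspace 'M[R]_n}).
Variables (A : 'M[R]_n) (e d c : R).
Hypothesis psdS : forall y, S y -> psdmx y.
Hypothesis congrS : forall y M, S y -> S (M^T *m y *m M).
Hypothesis Sx : S x.
Hypotheses (d_gt0 : 0 < d) (c_ge0 : 0 <= c).
Hypothesis near : forall y, S y -> `|y - x| < d -> exists B C,
  [/\ tangent y B C \in E, `|tangent y B C - A| <= e & `|C| <= c].

(** [m] bounds the norm of [y] on the ball around [x]. The two terms of [speed] bound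
    [y *m C + C^T *m y] and [C^T *m y *m C]. *)
Let m := `|x| + d.
Let speed := 2 * (n%:R * (m * c)) + n%:R * (c * (n%:R * (m * c))).

(** Take [y'] congruent to [y] by [1%:M + h *: C], and [W] the second-order term of its expansion.
    Then [y + h *: T + W - y'] is [h *: (B *m B^T)], the discarded PSD term. *)
Lemma flow_step (h : R) y : 0 <= h <= 1 -> S y -> `|y - x| < d ->
  exists y' T W, [/\ S y', `|y' - y| <= h * speed, T \in E & `|T - A| <= e]
    /\ psdmx (y + h *: T + W - y') /\ `|W| <= h ^+ 2 * speed.
Proof.
move=> /andP[h0 h1] Sy yx; have [B [C [TE TA Cc]]] := near Sy yx.
have sy := psdmx_tr (psdS Sy).
have n0 : 0 <= n%:R :> R by [].
have ym : `|y| <= m.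
  by rewrite -[y](subrK x) addrC (le_trans (ler_normD _ _)) // lerD2l ltW.
have m0 : 0 <= m := le_trans (normr_ge0 _) ym.
have yC : `|y *m C| <= n%:R * (m * c).
  by rewrite (le_trans (mx_norm_mul _ _)) // ler_wpM2l // ler_pM.
have Cy : `|C^T *m y| <= n%:R * (m * c).
  by rewrite -mx_norm_tr trmx_mul trmxK sy.
have CyC : `|C^T *m y *m C| <= n%:R * (c * (n%:R * (m * c))).
  rewrite -mulmxA (le_trans (mx_norm_mul _ _)) // ler_wpM2l // mx_norm_tr.
  by rewrite ler_pM.
have h2 : h ^+ 2 <= h by rewrite expr2 ler_piMr.
pose M := 1%:M + h *: C.
have eM : M^T *m y *m M =
    y + h *: (y *m C + C^T *m y) + h ^+ 2 *: (C^T *m y *m C).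
  have -> : M^T = 1%:M + h *: C^T by rewrite /M linearD linearZ /= trmx1.
  rewrite /M mulmxDl mul1mx -scalemxAl.
  rewrite mulmxDr mulmx1 -scalemxAr mulmxDl -scalemxAl scalerDr scalerA -expr2.
  by rewrite scalerDr addrA [h *: _ + h *: _]addrC !addrA.
exists (M^T *m y *m M), (tangent y B C), (h ^+ 2 *: (C^T *m y *m C)).
split; [split=> //|split].
- exact: congrS.
- rewrite eM -[y + _ + _]addrA addrAC subrr add0r (le_trans (ler_normD _ _)) //.
  rewrite !normrZ (ger0_norm h0) -expr2 mulrDr lerD //.
    by rewrite ler_wpM2l // (le_trans (ler_normD _ _)) //; lra.
  by rewrite ler_pM // sqr_ge0.
- have -> : y + h *: tangent y B C + h ^+ 2 *: (C^T *m y *m C) - M^T *m y *m M =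
      h *: (B *m B^T).
    rewrite eM /tangent scalerDr; apply/eqP; rewrite subr_eq; apply/eqP.
    by rewrite !addrA [h *: (B *m _) + y]addrC.
  by apply: psdmxZ => //; exact: psdmx_mul_tr.
- rewrite normrZ normrX (ger0_norm h0) ler_wpM2l ?sqr_ge0 //.
  by rewrite (le_trans CyC) // lerDr !mulr_ge0.
Qed.

(** The steps, the PSD defects and the errors all add up; [j%:R * h * speed < d] keeps the points in
    the ball where directions are available. *)
Lemma flow_iter (h : R) j : 0 <= h <= 1 -> j%:R * h * speed < d ->
  exists y Z W, [/\ S y, `|y - x| <= j%:R * h * speed, Z \in E &
    `|Z - (j%:R * h) *: A| <= j%:R * h * e] /\ psdmx (x + Z + W - y) /\
    `|W| <= j%:R * h ^+ 2 * speed.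
Proof.
move=> h01; have m0 : 0 <= m by rewrite addr_ge0 // ltW.
have speed_ge0 : 0 <= speed by rewrite addr_ge0 // !mulr_ge0.
have [h0 _] := andP h01.
elim: j => [|j IH] jd.
  exists x, 0, 0; rewrite subrr !mul0r scale0r subrr !addr0 normr0 mem0v subrr.
  split=> //; split=> //; have := @psdmx_mul_tr R n n 0; rewrite mul0mx; exact.
have jlt : j%:R * h * speed < d.
  apply: le_lt_trans jd; rewrite ler_wpM2r // ler_wpM2r //.
  by rewrite ler_nat.
have [y [Z [W [[Sy yx ZE ZA] [psd Wle]]]]] := IH jlt.
have [y' [T [W' [[Sy' yy' TE TA] [psd' W'le]]]]] :=
  flow_step h01 Sy (le_lt_trans yx jlt).
exists y', (Z + h *: T), (W + W'); split; [split=> //|split].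
- rewrite -[y' - x](subrKA y) (le_trans (ler_normD _ _)) //.
  by rewrite -natr1 !mulrDl mul1r addrC lerD.
- by rewrite memvD // memvZ.
- rewrite -natr1 !mulrDl mul1r scalerDl opprD addrACA.
  rewrite (le_trans (ler_normD _ _)) // lerD // -scalerBr normrZ (ger0_norm h0).
  by rewrite ler_wpM2l.
- have -> : x + (Z + h *: T) + (W + W') - y' =
      (x + Z + W - y) + (y + h *: T + W' - y').
    rewrite [RHS]addrA -[y + _ + _]addrA [_ - y + _]addrA subrK.
    by rewrite [x + (Z + _)]addrA addrACA.
  exact: psdmxD.
- rewrite (le_trans (ler_normD _ _)) // -natr1 !mulrDl mul1r.
  by rewrite lerD.
Qed.

(** [N.+1] steps of length [t / N.+1%:R] cover a fixed time [t] with error at most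
    [speed / N.+1%:R]. A cluster point [Z] of the total displacements lies within [t * e] of
    [t *: A], hence is nonzero, and [x + Z] is a limit of PSD matrices. *)
Lemma flow : e < `|A| -> exists Z, [/\ Z \in E, Z != 0 & psdmx (x + Z)].
Proof.
move=> eA; have m0 : 0 <= m by rewrite addr_ge0 // ltW.
have speed_ge0 : 0 <= speed by rewrite addr_ge0 // !mulr_ge0.
(* Small enough for the whole path to stay in the ball; the 1 added to [speed] avoids a zero
   denominator. *)
pose t := Num.min 1 (d / (speed + 1)).
have t_gt0 : 0 < t by rewrite lt_min ltr01 divr_gt0 //; lra.
have t_le1 : t <= 1 by rewrite ge_min lexx.
have td : t * speed < d.
  have : t <= d / (speed + 1) by rewrite ge_min lexx orbT.
  by rewrite ler_pdivlMr; last lra; nra.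
have uP N : exists Z, [/\ Z \in E, `|Z - t *: A| <= t * e &
    exists2 W, psdmx (x + Z + W) & `|W| <= speed / N.+1%:R].
  have N0 : 0 < N.+1%:R :> R by [].
  have jh : N.+1%:R * (t / N.+1%:R) = t by rewrite mulrC divfK // lt0r_neq0.
  have h01 : 0 <= t / N.+1%:R <= 1.
    apply/andP; split; first by rewrite divr_ge0 // ltW.
    by rewrite ler_pdivrMr // mul1r (le_trans t_le1) // ler1n.
  have := @flow_iter (t / N.+1%:R) N.+1 h01; rewrite jh => /(_ td).
  move=> [y [Z [W [[Sy yx ZE ZA] [psd Wle]]]]]; exists Z; split => //; exists W.
    by rewrite -[x + Z + W](subrK y); apply: psdmxD => //; exact: psdS.
  have -> : speed / N.+1%:R = 1 * (speed / N.+1%:R) by rewrite mul1r.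
  rewrite (le_trans Wle) // (_ : _ * speed = t ^+ 2 * (speed / N.+1%:R)).
    by rewrite ler_wpM2r ?divr_ge0 // expr_le1 // ltW.
  by move: N.+1%:R N0 => q q0; field; exact: lt0r_neq0.
have [u {}uP] := choice uP.
have [|Z clZ] := @mx_cluster R n n u (t * e + `|t *: A|).
  move=> j; have [_ h _] := uP j.
  by rewrite -[u j](subrK (t *: A)) (le_trans (ler_normD _ _)) // lerD2r.
exists Z; split.
- apply: vspace_closed => eps eps_gt0; have [j _ uZ] := clZ eps 0%N eps_gt0.
  by exists (u j) => //; have [] := uP j.
- have ta : t * e < `|t *: A| by rewrite normrZ gtr0_norm // ltr_pM2l.
  (* If [Z] were zero, some [u j] would have norm below the gap between [t * e] and the norm of
     [t *: A], although it is within [t * e] of [t *: A]. *)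
  apply/eqP => Z0; have [|j _] := clZ (`|t *: A| - t * e) 0%N; first lra.
  rewrite Z0 subr0 => uj; have [_ h _] := uP j.
  have : `|t *: A| <= `|u j - t *: A| + `|u j|.
    by rewrite -{1}[t *: A](subrK (u j)) distrC (le_trans (ler_normD _ _)).
  lra.
- apply: psdmx_closed => eps eps_gt0.
  have e2 : 0 < eps / 2 by lra.
  pose N := Num.Def.archi_bound (speed / (eps / 2)).
  have [j Nj uZ] := clZ _ N e2; have [_ _ [W psdW Wle]] := uP j.
  exists (x + u j + W) => //.
  rewrite (_ : _ - _ = (u j - Z) + W); last first.
    by rewrite addrAC opprD addrACA subrr add0r.
  rewrite (le_lt_trans (ler_normD _ _)) //.
  suff /(le_lt_trans Wle) : speed / j.+1%:R < eps / 2.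
    by move/(ltrD uZ); rewrite -splitr.
  rewrite ltr_pdivrMr // mulrC -ltr_pdivrMr //.
  have sp : 0 <= speed / (eps / 2) by rewrite divr_ge0 // ltW.
  apply: lt_le_trans (archi_boundP sp) _.
  by rewrite ler_nat (leq_trans Nj).
Qed.

End Flow.

(** * Separation and the dual solution *)

Section Inner.
Variables (R : realType) (n : nat).
Implicit Types (A B C D M : 'M[R]_n).

Lemma mxinnerE A B : mxinner A B = \sum_i \sum_j A i j * B i j.
Proof.
rewrite /mxinner /mxtrace exchange_big; apply: eq_bigr => j _.
by rewrite mxE; apply: eq_bigr => i _; rewrite mxE.
Qed.

Lemma mxinnerC A B : mxinner A B = mxinner B A.
Proof. by rewrite /mxinner -mxtrace_tr trmx_mul trmxK. Qed.

Lemma mxinnerDr A B C : mxinner A (B + C) = mxinner A B + mxinner A C.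
Proof. by rewrite /mxinner mulmxDr mxtraceD. Qed.

Lemma mxinnerZr A a B : mxinner A (a *: B) = a * mxinner A B.
Proof. by rewrite /mxinner -scalemxAr mxtraceZ. Qed.

Lemma mxinnerBr A B C : mxinner A (B - C) = mxinner A B - mxinner A C.
Proof. by rewrite -scaleN1r mxinnerDr mxinnerZr mulN1r. Qed.

Lemma mxinnerDl A B C : mxinner (A + B) C = mxinner A C + mxinner B C.
Proof. by rewrite !(mxinnerC _ C) mxinnerDr. Qed.

Lemma mxinnerZl a A B : mxinner (a *: A) B = a * mxinner A B.
Proof. by rewrite !(mxinnerC _ B) mxinnerZr. Qed.

Lemma mxinnerBl A B C : mxinner (A - B) C = mxinner A C - mxinner B C.
Proof. by rewrite !(mxinnerC _ C) mxinnerBr. Qed.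

Lemma mxinner_ge0 A : 0 <= mxinner A A.
Proof.
by rewrite mxinnerE; do 2!apply: sumr_ge0 => ? _; rewrite -expr2 sqr_ge0.
Qed.

Lemma mxinner_eq0 A : mxinner A A = 0 -> A = 0.
Proof.
rewrite mxinnerE => /eqP; rewrite psumr_eq0 => [/allP h|]; last first.
  by move=> i _; apply: sumr_ge0 => j _; rewrite -expr2 sqr_ge0.
apply/matrixP => i j; have := h i (mem_index_enum _).
rewrite /= psumr_eq0 => [/allP {}h|]; last by move=> ? _; rewrite -expr2 sqr_ge0.
have := h j (mem_index_enum _); rewrite -expr2 sqrf_eq0 => /eqP ->.
by rewrite mxE.
Qed.

Lemma mxinner_row A (v : 'rV[R]_n) : mxinner A (v^T *m v) = mxform A^T v v.
Proof. by rewrite /mxinner mulmxA mxtrace_mulC mulmxA /mxtrace big_ord1. Qed.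

Lemma mxinner_mul_tr m A (M : 'M[R]_(n, m)) :
  mxinner A (M *m M^T) = \sum_j mxform A^T (col j M)^T (col j M)^T.
Proof.
rewrite /mxinner mulmxA mxtrace_mulC mulmxA /mxtrace; apply: eq_bigr => j _.
rewrite /mxform trmxK tr_col -row_mul !mxE; apply: eq_bigr => k _.
by rewrite [row _ _ _ _]mxE [col _ _ _ _]mxE.
Qed.

(** [B] is the image of [A] under the adjoint of [f], given by its entries. *)
Lemma mxinner_riesz (f : {linear 'M[R]_n -> 'M[R]_n}) A :
  exists B, forall D, mxinner A (f D) = mxinner B D.
Proof.
exists (\matrix_(i, j) mxinner A (f (delta_mx i j))) => D.
have inner_sum (I : finType) (F : I -> 'M[R]_n) :
    mxinner A (\sum_i F i) = \sum_i mxinner A (F i).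
  by rewrite /mxinner mulmx_sumr linear_sum.
rewrite {1}[D]matrix_sum_delta linear_sum inner_sum mxinnerE.
apply: eq_bigr => i _; rewrite linear_sum inner_sum; apply: eq_bigr => j _.
by rewrite linearZ mxinnerZr mulrC mxE.
Qed.

Lemma mxinner_norm A B : `|mxinner A B| <= (n * n)%:R * (`|A| * `|B|).
Proof.
rewrite mxinnerE (le_trans (ler_norm_sum _ _ _)) //.
have -> : (n * n)%:R * (`|A| * `|B|) = \sum_(i < n) \sum_(j < n) `|A| * `|B|.
  by rewrite !sumr_const card_ord -mulrnA mulr_natl.
apply: ler_sum => i _; rewrite (le_trans (ler_norm_sum _ _ _)) //.
by apply: ler_sum => j _; rewrite normrM ler_pM // le_mx_norm.
Qed.

Lemma psdmx_inner_ge0 A B : psdmx A -> psdmx B -> 0 <= mxinner A B.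
Proof.
move=> psdA /psdmx_factor[m [M ->]]; rewrite mxinner_mul_tr (psdmx_tr psdA).
by apply: sumr_ge0 => j _; case: psdA => _; apply.
Qed.

Lemma psdmx_form_eq0 A v : psdmx A -> mxform A v v = 0 -> v *m A = 0.
Proof.
move=> /psdmx_factor[m [M ->]] h.
suff -> : v *m (M *m M^T) = v *m M *m M^T.
  suff /eqP -> : v *m M == 0 by rewrite mul0mx.
  by rewrite -mulmx_tr_eq0 -h /mxform trmx_mul !mulmxA.
by rewrite mulmxA.
Qed.

(** With [B = M *m M^T] the inner product is a sum of nonnegative values of the form of [A] at the
    columns of [M]. Each is zero, so [A] kills each column. *)
Lemma psdmx_inner_eq0 A B : psdmx A -> psdmx B -> mxinner A B = 0 -> A *m B = 0.
Proof.
move=> psdA /psdmx_factor[m [M ->]]; rewrite mxinner_mul_tr (psdmx_tr psdA).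
move/eqP; rewrite psumr_eq0 => [/allP h|]; last by move=> j _; case: psdA => _; apply.
suff -> : A *m (M *m M^T) = A *m M *m M^T.
  suff -> : A *m M = 0 by rewrite mul0mx.
  apply/trmx_inj; rewrite trmx_mul (psdmx_tr psdA) trmx0.
  apply/row_matrixP => j; rewrite row_mul row0 -tr_col.
  apply: psdmx_form_eq0 => //; apply/eqP; exact: h (mem_index_enum _).
by rewrite mulmxA.
Qed.

End Inner.

(** * Gordan's alternative for a face of the PSD cone *)

Section Gordan.
Variables (R : realType) (n : nat).
Implicit Types (A B C D x : 'M[R]_n).

(** Makes the set of PSD matrices of trace 1 bounded, hence the base of the cone compact. *)
Lemma psdmx_norm_trace D : psdmx D -> `|D| <= \tr D.
Proof.
move=> psdD; have tr_ge i : D i i <= \tr D.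
  by rewrite /mxtrace (bigD1 i) //= lerDl sumr_ge0 // => j _; exact: psdmx_diag_ge0.
apply: mx_norm_le => [|i j].
  by apply: sumr_ge0 => i _; exact: psdmx_diag_ge0.
have := psdmx_norm_le i j psdD; have := tr_ge i; have := tr_ge j; lra.
Qed.

Lemma linear_cluster m1 n1 m2 n2 (f : {linear 'M[R]_(m1, n1) -> 'M[R]_(m2, n2)})
    (u : nat -> 'M[R]_(m1, n1)) Z w :
  (forall (e : R) N, 0 < e -> exists2 k, (N <= k)%N & `|u k - Z| < e) ->
  (forall k, f (u k) = w) -> f Z = w.
Proof.
move=> clZ fu; have [K K_gt0 fK] := linear_bounded f.
apply/eqP; rewrite eq_sym -subr_eq0 -normr_le0; apply/ler_addgt0Pr => e e_gt0.
rewrite add0r; have [k _ uk] := clZ (e / K) 0%N (divr_gt0 e_gt0 K_gt0).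
rewrite -(fu k) -linearB (le_trans (fK _)) // mulrC -ler_pdivlMr //.
exact: ltW.
Qed.

(* [B] is read off the point of smallest [g] on the compact convex base of the
   cone, where [g] is the squared norm of a projection with kernel [E]. *)
Lemma psd_gordan (E : {vspace 'M[R]_n}) x :
  (forall D, D \in E -> psdmx D -> D *m x = 0 -> D = 0) ->
  exists B, (forall A, A \in E -> mxinner B A = 0) /\
    forall D, psdmx D -> D *m x = 0 -> D != 0 -> 0 < mxinner B D.
Proof.
move=> E0; pose base D := [/\ psdmx D, D *m x = 0 & \tr D = 1].
have tr_gt0 D : psdmx D -> D != 0 -> 0 < \tr D.
  by move=> /psdmx_norm_trace; rewrite -normr_gt0 => h /lt_le_trans; apply.
have [[D1 base1]|nobase] := pselect (exists D, base D); last first.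
  (* With an empty base the cone is zero, and [B = 0] satisfies the positivity vacuously. *)
  exists 0; split=> [A _|D psdD Dx D0]; first by rewrite /mxinner trmx0 mul0mx mxtrace0.
  case: nobase; exists ((\tr D)^-1 *: D); have t0 := tr_gt0 D psdD D0; split.
  - by apply: psdmxZ => //; rewrite invr_ge0 ltW.
  - by rewrite -scalemxAl Dx scaler0.
  - by rewrite mxtraceZ mulVf // lt0r_neq0.
pose f := \1%VF - projv E.
have fE A : A \in E -> f A = 0.
  by move=> AE; rewrite !lfunE /= !lfunE /= projv_id // subrr.
have f0E A : f A = 0 -> A \in E.
  by rewrite !lfunE /= !lfunE /= => /subr0_eq ->; exact: memv_proj.
pose g D := mxinner (f D) (f D).
pose V := [set r | exists2 D, base D & g D = r].
have V0 : V !=set0 by exists (g D1), D1.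
have Vlb : has_lbound V by exists 0 => r [D _ <-]; exact: mxinner_ge0.
have uP k : exists D, base D /\ g D < inf V + k.+1%:R^-1.
  have [|_ [D bD <-] lt] := @inf_adherent R V k.+1%:R^-1 _ (conj V0 Vlb).
    by rewrite invr_gt0.
  by exists D.
have [u {}uP] := choice uP.
have u1 k : `|u k| <= 1.
  by have [[psdu _ tu] _] := uP k; rewrite -tu psdmx_norm_trace.
have [D0 cl0] := mx_cluster u1.
have base0 : base D0; first split.
- apply: psdmx_closed => e e_gt0; have [k _ uk] := cl0 e 0%N e_gt0.
  by exists (u k) => //; have [[]] := uP k.
- apply: (@linear_cluster _ _ _ _ (mulmxr x) u) => // k.
  by have [[]] := uP k.
- have trE D : \tr D = mxinner 1%:M D by rewrite /mxinner trmx1 mul1mx.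
  pose H := (n * n)%:R * `|1%:M : 'M[R]_n| + 1.
  have H_gt0 : 0 < H by rewrite ltr_wpDl // mulr_ge0.
  apply/eqP; rewrite -subr_eq0 -normr_le0; apply/ler_addgt0Pr => e e_gt0.
  rewrite add0r; have [k _ uk] := cl0 (e / H) 0%N (divr_gt0 e_gt0 H_gt0).
  have [[_ _ <-] _] := uP k; rewrite !trE -mxinnerBr.
  rewrite (le_trans (mxinner_norm _ _)) // mulrA.
  apply: le_trans (_ : H * (e / H) <= _); last by rewrite mulrC divfK // lt0r_neq0.
  by rewrite ler_pM ?mulr_ge0 ?lerDl // distrC ltW.
have gmin D : base D -> g D0 <= g D.
  move=> bD; have [K K_gt0 fK] := linear_bounded f.
  have gD : inf V <= g D by apply: ge_inf => //; exists D.
  apply: le_trans gD; apply/ler_addgt0Pr => e e_gt0.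
  (* [H - 1] bounds the growth of [g] near [D0]: the difference [g D0 - g (u k)] factors as the
     inner product of the images under [f] of [D0 - u k] and [D0 + u k]. *)
  pose H := (n * n)%:R * (K * (K * (1 + `|D0|))) + 1.
  have H_gt0 : 0 < H by rewrite ltr_wpDl // !mulr_ge0 ?addr_ge0 // ltW.
  pose N := Num.Def.archi_bound (2 / e).
  have [k Nk uk] := cl0 (e / 2 / H) N ltac:(rewrite !divr_gt0 //).
  have [_ gu] := uP k.
  have ke : k.+1%:R^-1 < e / 2.
    have e2 : 0 < 2 / e by rewrite divr_gt0.
    rewrite -[e / 2]invrK ltf_pV2 ?posrE ?invr_gt0 ?divr_gt0 // invf_div.
    apply: lt_le_trans (archi_boundP (ltW e2)) _.
    by rewrite ler_nat (leq_trans Nk).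
  suff : g D0 - g (u k) <= e / 2.
    by move: (g D0) (g (u k)) (inf V) k.+1%:R^-1 gu ke => p q' r s *; lra.
  have -> : g D0 - g (u k) = mxinner (f (D0 - u k)) (f (D0 + u k)).
    rewrite linearB linearD mxinnerBl !mxinnerDr (mxinnerC (f (u k)) (f D0)) /g.
    by ring.
  apply: le_trans (ler_norm _) _; apply: le_trans (mxinner_norm _ _) _.
  apply: le_trans (_ : (n * n)%:R * ((K * (e / 2 / H)) * (K * (1 + `|D0|))) <= _).
    rewrite ler_wpM2l // ler_pM //.
      by rewrite (le_trans (fK _)) // ler_pM2l // distrC ltW.
    rewrite (le_trans (fK _)) // ler_pM2l // (le_trans (ler_normD _ _)) //.
    by rewrite addrC lerD2r.
  have eH : H - 1 = (n * n)%:R * (K * (K * (1 + `|D0|))) by rewrite /H addrK.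
  have -> : (n * n)%:R * (K * (e / 2 / H) * (K * (1 + `|D0|))) =
      e / 2 / H * (H - 1) by rewrite eH; ring.
  have -> : e / 2 / H * (H - 1) = e / 2 - e / 2 / H.
    by rewrite mulrBr mulr1 divfK // lt0r_neq0.
  by rewrite gerBl !divr_ge0 // ltW.
(* [B] represents the functional sending [D] to the inner product of [f D0] and [f D], which
   vanishes on [E], the kernel of [f]. *)
have [B hB] := mxinner_riesz f (f D0).
have fB D : mxinner (f D0) (f D) = mxinner B D by exact: hB.
exists B; split=> [A AE|D psdD Dx D_neq0].
  by rewrite -fB (fE A AE) /mxinner mulmx0 mxtrace0.
have g0 : 0 < g D0.
  rewrite lt0r mxinner_ge0 andbT; apply/eqP => /mxinner_eq0 /f0E D0E.
  have [psd0 D0x t0] := base0; have := E0 _ D0E psd0 D0x => D00.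
  by move: t0; rewrite D00 mxtrace0 => /eqP; rewrite eq_sym oner_eq0.
have t_gt0 := tr_gt0 _ psdD D_neq0.
pose D2 := (\tr D)^-1 *: D.
have base2 : base D2; first split.
- by apply: psdmxZ => //; rewrite invr_ge0 ltW.
- by rewrite -scalemxAl Dx scaler0.
- by rewrite mxtraceZ mulVf // lt0r_neq0.
suff : g D0 <= mxinner B D2.
  move=> /(lt_le_trans g0); rewrite mxinnerZr pmulr_rgt0 ?invr_gt0 //.
clearbody D2; rewrite -fB -subr_ge0 leNgt; apply/negP => s_lt0.
set s := mxinner _ _ - _ in s_lt0; pose q := g (D2 - D0).
have q_ge0 : 0 <= q := mxinner_ge0 _.
(* The increase of [g] from [D0] to the point [(1 - t) *: D0 + t *: D2] of the base, nonnegative by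
   minimality. *)
have gt t : 0 <= t -> t <= 1 -> 0 <= 2 * t * s + t ^+ 2 * q.
  move=> t0 t1; have baset : base ((1 - t) *: D0 + t *: D2).
    have [p0 x0 r0] := base0; have [p2 x2 r2] := base2; split.
    - by apply: psdmxD; apply: psdmxZ => //; rewrite subr_ge0.
    - by rewrite mulmxDl -!scalemxAl x0 x2 !scaler0 addr0.
    - by rewrite mxtraceD !mxtraceZ r0 r2 !mulr1 subrK.
  have := gmin _ baset; rewrite -subr_ge0; congr (0 <= _).
  rewrite /s /q /g linearD !linearZ linearB /=.
  rewrite !(mxinnerBr, mxinnerBl, mxinnerDr, mxinnerDl, mxinnerZr, mxinnerZl).
  by rewrite (mxinnerC (f D2) (f D0)); ring.
(* For negative [s] this [t] makes [2 * s + t * q] negative, against the preceding inequality. *)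
pose t := Num.min 1 (- s / (q + 1)).
have q1 : 0 < q + 1 by rewrite ltr_wpDl.
have t_pos : 0 < t by rewrite lt_min ltr01 divr_gt0 // oppr_gt0.
have t_le1 : t <= 1 by rewrite ge_min lexx.
have tq : t * (q + 1) <= - s by rewrite -ler_pdivlMr // ge_min lexx orbT.
have := gt t (ltW t_pos) t_le1.
have -> : 2 * t * s + t ^+ 2 * q = t * (2 * s + t * q) by ring.
rewrite mulrDr mulr1 in tq; rewrite pmulr_rge0 // => h.
have aux (a b c : R) : 0 <= 2 * a + b -> b + c <= - a -> 0 < c -> a < 0 -> False.
  by clear; lra.
exact: aux h tq t_pos s_lt0.
Qed.

End Gordan.

(** * Strict complementarity at a generic unique optimum *)

Section Main.
Variables (R : realType) (n : nat).
Implicit Types (A C D M x y : 'M[R]_n) (L E : {vspace 'M[R]_n}).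

(** For symmetric [x] the row space and the kernel are orthogonal, so they meet in 0, and their
    dimensions add up to [n]. *)
Lemma sym_row_kernel x (v : 'rV[R]_n) : x^T = x ->
  exists a w : 'rV[R]_n, v = a *m x + w /\ w *m x = 0.
Proof.
move=> sx.
have cap0 : (x :&: kermx x = 0)%MS.
  apply/eqP; rewrite -submx0; apply/rV_subP => u.
  rewrite sub_capmx => /andP[/submxP[a ->] /sub_kermxP ax]; rewrite submx0.
  by rewrite -mulmx_tr_eq0 trmx_mul sx mulmxA ax mul0mx mxE.
have full : row_full (x + kermx x)%MS.
  have := mxrank_sum_cap x (kermx x); rewrite cap0 mxrank0 addn0 mxrank_ker.
  by rewrite subnKC ?rank_leq_row // /row_full => ->.
have /sub_addsmxP[[a b] /= ->] := submx_full v full.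
by exists a, (b *m kermx x); split => //; rewrite -mulmxA mulmx_ker mulmx0.
Qed.

Lemma psdmx_rank_le_congr r y M : psdmx_rank_le r y -> psdmx_rank_le r (M^T *m y *m M).
Proof.
move=> [psdy ry]; split; first by have := psdmx_congr M^T psdy; rewrite trmxK.
by rewrite (leq_trans (mxrankM_maxl _ _)) // (leq_trans (mxrankM_maxr _ _)).
Qed.

Lemma tangent_sym k y (B : 'M[R]_(n, k)) C : y^T = y ->
  (tangent y B C)^T = tangent y B C.
Proof.
move=> sy; rewrite /tangent !linearD /= !trmx_mul !trmxK sy.
by rewrite [_ + C^T *m y]addrC.
Qed.

Lemma rat_innerE (q : 'M[rat]_n) A : rat_inner q A = mxinner (map_mx ratr q) A.
Proof.
rewrite mxinnerE; apply: eq_bigr => i _; apply: eq_bigr => j _.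
by rewrite mxE.
Qed.

Section Generic.
Variables (E : {vspace 'M[R]_n}) (x : 'M[R]_n) (r : nat) (eqs : seq 'M[rat]_n).
Hypothesis EP : forall A, A \in E <->
  A \is symmetricmx /\ forall q, q \in eqs -> rat_inner q A = 0.
Hypothesis gen : generic_in (@psdmx_rank_le R n r) x.
Hypothesis uniq : forall Z, Z \in E -> psdmx (x + Z) -> Z = 0.

Let sx : x^T = x.
Proof. by have [[/psdmx_tr]] := gen. Qed.

(** A nonzero tangent direction in [E] would persist at nearby points of the family, and [flow]
    would turn it into a nonzero [Z] in [E] with [x + Z] PSD, against uniqueness. *)
Lemma generic_no_tangent k (B : 'M[R]_(n, k)) C :
  tangent x B C \in E -> tangent x B C = 0.
Proof.
move=> TE; apply/eqP/negP => /negP T0.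
have e_gt0 : 0 < `|tangent x B C| / 2 by rewrite divr_gt0 // normr_gt0.
(* The half norm keeps the nearby directions away from zero, as [flow] requires; the 1 yields the
   bound [|C| + 1] on the nearby [C']. *)
pose e := Num.min (`|tangent x B C| / 2) 1.
have e0 : 0 < e by rewrite lt_min e_gt0 ltr01.
have [_ eqsx] := (EP _).1 TE.
have := generic_tangent gen e0 eqsx; rewrite near_withinE => /nbhs_normP.
move=> [d /= d_gt0 near].
have c_ge0 : 0 <= `|C| + 1 by rewrite addr_ge0.
have [|||||y Sy yx||Z [ZE Z0 psdZ]] := @flow R n k (@psdmx_rank_le R n r) x E
  (tangent x B C) (`|tangent x B C| / 2) d (`|C| + 1).
- by move=> y [].
- by move=> y M; exact: psdmx_rank_le_congr.
- by case: gen.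
- exact: d_gt0.
- exact: c_ge0.
- have [|B' [C' [eq' T' C'C]]] := near y _ Sy; first by rewrite /= distrC.
  exists B', C'; split.
  (* Only the rational equations had to be transferred: tangent matrices at a symmetric [y] are
     symmetric. *)
  + apply/EP; split => //; apply/symmxP/tangent_sym.
    by case: Sy => /psdmx_tr.
  + apply: mx_norm_le => [|i j]; first exact: ltW.
    by apply/ltW/(lt_le_trans (T' i j)); rewrite ge_min lexx.
  + rewrite -[C'](subrK C) (le_trans (ler_normD _ _)) // addrC lerD2l.
    apply: mx_norm_le => // i j.
    by apply/ltW/(lt_le_trans (C'C i j)); rewrite ge_min lexx orbT.
- by rewrite ltr_pdivrMr // mulr_natr mulr2n ltrDl normr_gt0.
- by move/eqP: Z0; apply; exact: uniq.
Qed.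

(** [psd_gordan] for [E] enlarged by all [x *m C + C^T *m x]. Orthogonality to the added matrices
    gives [Omega *m x = 0], and strict positivity on the kernel of [x] confines the isotropic
    vectors to the row space of [x]. *)
Lemma generic_dual : exists Omega, [/\ psdmx Omega,
  forall A, A \in E -> mxinner Omega A = 0, Omega *m x = 0
  & forall v, mxform Omega v v = 0 -> (v <= x)%MS].
Proof.
pose h C := x *m C + C^T *m x.
have h_lin : linear h.
  move=> a C C'; rewrite /h (_ : (a *: C + C')^T = a *: C^T + C'^T).
    by rewrite mulmxDr mulmxDl -scalemxAr -scalemxAl addrACA scalerDr.
  by rewrite linearP.
pose hm := GRing.isLinear.Build R _ _ _ h h_lin.
pose hl : {linear 'M[R]_n -> 'M[R]_n} := HB.pack h hm.
pose E' := (E + limg (linfun hl))%VS.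
have hE' C : h C \in E'.
  apply: (subvP (addvSr _ _)); have -> : h C = linfun hl C by rewrite lfunE.
  by rewrite memv_img // memvf.
(* If [D = A + h C] is PSD and kills [x], factoring [D] exhibits [A] as tangent, so [A = 0]. Then
   [D = h C] is orthogonal to itself, because [D *m x] and [x *m D] vanish. *)
have [D|B0 [B0E' B0pos]] := @psd_gordan R n E' x.
  move=> /memv_addP[A AE [_ /memv_imgP[C _ ->]]]; rewrite lfunE /= => -> psdD Dx.
  set D' := A + h C in psdD Dx *.
  have [m [M eM]] := psdmx_factor psdD.
  have eA : A = tangent x M (- C).
    rewrite /tangent -eM (_ : (- C)^T = - C^T); last by rewrite linearN.
    rewrite mulmxN mulNmx -opprD -/(h C).
    by rewrite /D' addrK.
  have A0 : A = 0 by rewrite eA; apply: generic_no_tangent; rewrite -eA.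
  have xD : x *m D' = 0.
    by apply: trmx_inj; rewrite trmx_mul sx (psdmx_tr psdD) Dx trmx0.
  apply: mxinner_eq0; rewrite {2}/D' A0 add0r /mxinner (psdmx_tr psdD) mulmxDr.
  rewrite mxtraceD !mulmxA Dx mul0mx mxtrace0 add0r.
  by rewrite mxtrace_mulC !mulmxA xD mul0mx mxtrace0.
(* Symmetrizing only doubles the inner products with symmetric matrices. *)
pose Om := B0 + B0^T.
have sOm : Om^T = Om by rewrite /Om linearD /= trmxK addrC.
have OmE A : A^T = A -> mxinner Om A = 2 * mxinner B0 A.
  move=> sA; rewrite /Om mxinnerDl mulr2n mulrDl mul1r; congr (_ + _).
  by rewrite /mxinner trmxK -[in LHS]mxtrace_tr trmx_mul sA mxtrace_mulC.
have Omx : Om *m x = 0.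
  have sh C : (h C)^T = h C by rewrite /h linearD /= !trmx_mul trmxK sx addrC.
  (* For this choice of [C] the inner product is twice the squared norm of [Om *m x]. *)
  have h0 : mxinner Om (h (Om *m x)^T) = 0 by rewrite OmE // B0E' // mulr0.
  have : mxinner (Om *m x)^T (Om *m x)^T = 0.
    move: h0; rewrite /mxinner sOm /h trmxK mulmxDr mxtraceD !mulmxA.
    rewrite [X in _ + X]mxtrace_mulC !mulmxA.
    have -> : x *m Om = (Om *m x)^T by rewrite trmx_mul sx sOm.
    by rewrite -!mulmxA [X in _ + X]mxtrace_mulC !mulmxA; lra.
  by move/mxinner_eq0/(congr1 trmx); rewrite trmxK trmx0.
have xOm : x *m Om = 0.
  by apply: trmx_inj; rewrite trmx_mul sx sOm Omx trmx0.
have form a w : mxform Om (a *m x + w) (a *m x + w) = mxform Om w w.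
  have z u : mxform Om (a *m x) u = 0.
    by rewrite /mxform -(mulmxA a) xOm mulmx0 mul0mx mxE.
  by rewrite mxformDl z add0r (mxformC w) // mxformDl z add0r.
have wpos (w : 'rV[R]_n) : w *m x = 0 -> w != 0 -> 0 < mxform Om w w.
  move=> wx w0; rewrite -{1}sOm -mxinner_row OmE; last by rewrite trmx_mul trmxK.
  rewrite mulr_gt0 //; apply: B0pos.
  - by have := psdmx_mul_tr w^T; rewrite trmxK.
  - by rewrite -mulmxA wx mulmx0.
  - apply: contraNneq w0 => /(congr1 (fun M : 'M_n => \tr M)).
    by rewrite mxtrace_mulC mxtrace0 /mxtrace big_ord1 => /eqP; rewrite mulmx_tr_eq0.
exists Om; split => //.
- split; first exact/symmxP.
  move=> v; have [a [w [-> wx]]] := sym_row_kernel v sx.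
  rewrite -/(mxform _ _ _) form; have [->|/(wpos _ wx)/ltW//] := eqVneq w 0.
  by rewrite /mxform !mul0mx mxE.
- move=> A AE; rewrite OmE; last by have [/symmxP] := (EP _).1 AE.
  by rewrite B0E' ?mulr0 //; apply: (subvP (addvSl _ _)).
- move=> v; have [a [w [-> wx]]] := sym_row_kernel v sx.
  rewrite form; have [->|/(wpos _ wx)] := eqVneq w 0.
    by rewrite addr0 submxMl.
  by move=> /[swap] ->; rewrite ltxx.
Qed.

End Generic.

Lemma rational_mx_lift A : rational_mx A -> exists q : 'M[rat]_n, map_mx ratr q = A.
Proof.
move=> ratA.
have /choice[f fP] : forall ij : 'I_n * 'I_n,
    exists q : rat, ratr q = A ij.1 ij.2.
  by move=> ij; have [q _ <-] := ratA ij.1 ij.2; exists q.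
by exists (\matrix_(i, j) f (i, j)); apply/matrixP => i j; rewrite !mxE fP.
Qed.

(** [Omega - beta] is orthogonal to [y - x], so the objective grows from [x] to [y] by the inner
    product of [Omega] and [y], both PSD. *)
Lemma sdp_weak_duality L b beta x Omega y :
  complementary_pair L b beta x Omega -> primal_feasible L b y ->
  mxinner beta x <= mxinner beta y.
Proof.
move=> [[xL _] [dL psdO] Ox] [yL psdy]; have yxL : y - x \in L.
  by rewrite -[y - x](subrKA b) memvD // -opprB memvN.
have := dL _ yxL; rewrite mxinnerBl !mxinnerBr Ox.
have := psdmx_inner_ge0 psdO psdy; lra.
Qed.

End Main.

Theorem theorem3 (R : realType) (n r : nat)
    (L : {vspace 'M[R]_n}) (b beta x : 'M[R]_n)
    (r_gt0 : (0 < r)%N)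
    (sdp : is_sdp L b beta)
    (gap : gap_free L b beta)
    (ratL : rational_subspace L)
    (rat_beta : rational_mx beta)
    (opt : primal_optimal L b beta x)
    (uniq_opt : forall y : 'M[R]_n, primal_optimal L b beta y -> y = x)
    (gen : generic_in (@psdmx_rank_le R n r) x) :
  exists Omega : 'M[R]_n, strictly_complementary_pair L b beta x Omega.
Proof.
have [x0 [Omega0 comp0]] := gap.
have x0E : x0 = x.
  apply: uniq_opt; split; first by case: comp0.
  by move=> y; exact: sdp_weak_duality comp0.
rewrite x0E in comp0 => {x0 x0E}.
have [_ [dual0 psd0] comp] := comp0.
have [[xL psdx] xmin] := opt.
have [eqs eqsP] := ratL; have [qb qbE] := rational_mx_lift rat_beta.
(* [E] consists of the directions in [L] along which the objective is constant; rationality of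
   [beta] makes it rational. *)
have [E EP] : exists E : {vspace 'M[R]_n},
    forall A, A \in E <-> A \in L /\ mxinner beta A = 0.
  pose h A : 'M[R]_1 := (mxinner beta A)%:M.
  have h_lin : linear h.
    by move=> a A A'; rewrite /h mxinnerDr mxinnerZr scale_scalar_mx -raddfD.
  pose hm := GRing.isLinear.Build R _ _ _ h h_lin.
  pose hl : {linear 'M[R]_n -> 'M[R]_1} := HB.pack h hm.
  exists (L :&: lker (linfun hl))%VS => A.
  rewrite memv_cap memv_ker lfunE /=; split.
    by move=> /andP[-> /eqP/matrixP/(_ 0 0)]; rewrite !mxE.
  by move=> [-> Ab]; rewrite /= /h Ab raddf0 eqxx.
have EP' A : A \in E <-> A \is symmetricmx /\
    forall q, q \in qb :: eqs -> rat_inner q A = 0.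
  rewrite EP eqsP; split.
    move=> [[sA Aeqs] Ab]; split=> // q; rewrite inE => /predU1P[->|/Aeqs//].
    by rewrite rat_innerE qbE.
  move=> [sA Aeqs]; split; first split=> // q qe.
    by apply: Aeqs; rewrite inE qe orbT.
  by rewrite -qbE -rat_innerE Aeqs // mem_head.
have uniq Z : Z \in E -> psdmx (x + Z) -> Z = 0.
  move=> /EP[ZL Zb] psdxZ; have : x + Z = x.
    apply: uniq_opt; split; first by split=> //; rewrite addrAC memvD.
    by move=> y /xmin; rewrite mxinnerDr Zb addr0.
  by move/(congr1 (+%R (- x))); rewrite addKr addNr.
have [Om [psdO OE Ox Oker]] := generic_dual EP' gen uniq.
(* [Om] vanishes on the kernel of [beta] in [L], so the two functionals are proportional on [L]. *)
have [c cP] : exists c, forall A, A \in L -> mxinner Om A = c * mxinner beta A.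
  have [[A1 [A1L A1b]]|nob] := pselect (exists A, A \in L /\ mxinner beta A != 0).
    exists (mxinner Om A1 / mxinner beta A1) => A AL.
    have AE : A - (mxinner beta A / mxinner beta A1) *: A1 \in E.
      apply/EP; split; first by rewrite memvB // memvZ.
      by rewrite mxinnerBr mxinnerZr divfK // subrr.
    have := OE _ AE; rewrite mxinnerBr mxinnerZr => /eqP; rewrite subr_eq0.
    by move=> /eqP ->; rewrite mulrAC [RHS]mulrAC [mxinner beta A * _]mulrC.
  exists 0 => A AL; rewrite mul0r; apply/OE/EP; split=> //.
  by apply/eqP/negP => /negP Ab; apply: nob; exists A.
(* [c] may be zero or negative. Since [Omega0] agrees with [beta] on [L], adding [t *: Omega0]
   changes the factor to [c + t], positive for this [t]; dividing by it gives dual feasibility. *)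
pose t := `|c| + 1.
have ct : 0 < c + t by have := ler_norm (- c); rewrite normrN /t; lra.
have t_gt0 : 0 < t by rewrite ltr_wpDl.
have beta0 A : A \in L -> mxinner Omega0 A = mxinner beta A.
  by move=> /dual0; rewrite mxinnerBl => /eqP; rewrite subr_eq0 => /eqP.
pose Omega := (c + t)^-1 *: (Om + t *: Omega0).
have psdOm : psdmx Omega.
  apply: psdmxZ; first by rewrite invr_ge0 ltW.
  by apply: psdmxD => //; apply: psdmxZ => //; exact: ltW.
have Omx : Omega *m x = 0.
  have O0x := psdmx_inner_eq0 psd0 psdx comp.
  by rewrite -scalemxAl mulmxDl -scalemxAl Ox O0x scaler0 addr0 scaler0.
exists Omega; split; first split.
- by [].
- split=> // A AL; rewrite mxinnerBl mxinnerZl mxinnerDl mxinnerZl cP // beta0 //.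
  by rewrite -mulrDl mulKf ?subrr // lt0r_neq0.
- by rewrite /mxinner (psdmx_tr psdOm) Omx mxtrace0.
apply/eqP; rewrite eqn_leq; apply/andP; split.
  by rewrite addnC; exact: mulmx0_rank_max.
(* The lower bound on the ranks: where the form of [Omega] vanishes, so does that of its summand
   [Om], and such vectors lie in the row space of [x]. *)
have : (kermx Omega <= x)%MS.
  apply/rV_subP => v /sub_kermxP vO; apply: Oker; apply/eqP; rewrite eq_le.
  case: psdO => _ /(_ v) -> ; rewrite andbT.
  have : mxform Omega v v = 0 by rewrite /mxform vO mul0mx mxE.
  have E' : mxform Omega v v = (c + t)^-1 * (mxform Om v v + t * mxform Omega0 v v).
    rewrite /mxform /Omega -scalemxAr -scalemxAl mulmxDr mulmxDl -scalemxAr.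
    by rewrite -scalemxAl mxE [X in _ * X]mxE [X in _ * (_ + X)]mxE.
  rewrite E' => /eqP; rewrite mulf_eq0 invr_eq0 (negbTE (lt0r_neq0 ct)) /=.
  rewrite addr_eq0 => /eqP ->; rewrite oppr_le0 mulr_ge0 //; first exact: ltW.
  by case: psd0 => _; apply.
by move/mxrankS; rewrite mxrank_ker leq_subLR addnC.
Qed.
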